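(* Let $\alpha:A\to A$ be an endomorphism of a $C^*$-algebra $A$. Any transfer operator $\mathcal{L}$ for $\alpha$ is extendible. Its strictly continuous extension $\overline{\mathcal{L}}:M(A)\to M(A)$ is determined by the formula $$\overline{\mathcal{L}}(m)a=\mathcal{L}(m\alpha(a)),\qquad a\in A,\ m\in M(A).$$ In particular, $\overline{\mathcal{L}}(1)$ is a positive central element in $M(A)$, and if $\alpha$ is extendible then the triple $(M(A),\overline{\alpha},\overline{\mathcal{L}})$ is an Exel system.
   Context: A transfer operator for an endomorphism $\alpha:A\to A$ is a positive linear map $\mathcal{L}:A\to A$ with $\mathcal{L}(a\alpha(b))=\mathcal{L}(a)b$ for all $a,b\in A$; the triple $(A,\alpha,\mathcal{L})$ is then called an Exel system. $M(A)$ is the multiplier algebra of $A$ with unit $1$. A positive map $\varrho:A\to A$ is extendible if it extends to a strictly continuous map $\overline{\varrho}:M(A)\to M(A)$. *)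

(* Defs.v *)
From HB Require Import structures.
From mathcomp Require Import all_boot all_order all_algebra.
From mathcomp Require Import complex.
From mathcomp Require Import all_classical all_reals all_analysis.

Set Implicit Arguments.
Unset Strict Implicit.
Unset Printing Implicit Defensive.

Import Order.TTheory GRing.Theory Num.Theory.
Import numFieldNormedType.Exports.

Local Open Scope classical_set_scope.
Local Open Scope ring_scope.
Local Open Scope complex_scope.

Reserved Notation "x ** y" (at level 40, left associativity).

(* C*-algebras are complex and need not be unital; as usual in
   MathComp-Analysis the norm takes its (nonnegative real) values in the scalar
   field R[i]. *)
HB.mixin Record isCStarAlgebra (R : realType) A
    of CompleteNormedModule R[i] A := {
  cmul : A -> A -> A;
  star : A -> A;
  cmulA : associative cmul;
  cmulDl : left_distributive cmul +%R;
  cmulDr : right_distributive cmul +%R;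
  cmulZl : forall (l : R[i]) (x y : A), cmul (l *: x) y = l *: cmul x y;
  cmulZr : forall (l : R[i]) (x y : A), cmul x (l *: y) = l *: cmul x y;
  ler_cnormM : forall x y : A, `|cmul x y| <= `|x| * `|y|;
  starK : involutive star;
  starD : {morph star : x y / x + y};
  starZ : forall (l : R[i]) (x : A), star (l *: x) = (l^*)%R *: star x;
  starM : forall x y : A, star (cmul x y) = cmul (star y) (star x);
  cstar_identity : forall x : A, `|cmul (star x) x| = `|x| ^+ 2
}.

#[short(type="cstarAlgType")]
HB.structure Definition CStarAlgebra (R : realType) :=
  {A of CompleteNormedModule R[i] A & isCStarAlgebra R A}.

Notation "x ** y" := (cmul x y) : ring_scope.

Section CStarTheory.
Context {R : realType} {A : cstarAlgType R}.
Implicit Types x y z : A.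

Lemma cmul0l x : 0 ** x = 0.
Proof. by rewrite -[X in X ** x](scale0r (0 : A)) cmulZl scale0r. Qed.

Lemma cmul0r x : x ** 0 = 0.
Proof. by rewrite -[X in x ** X](scale0r (0 : A)) cmulZr scale0r. Qed.

Lemma cmulNl x y : (- x) ** y = - (x ** y).
Proof. by rewrite -scaleN1r cmulZl scaleN1r. Qed.

Lemma cmulNr x y : x ** (- y) = - (x ** y).
Proof. by rewrite -scaleN1r cmulZr scaleN1r. Qed.

Lemma cmulBl x y z : (x - y) ** z = x ** z - y ** z.
Proof. by rewrite cmulDl cmulNl. Qed.

Lemma cmulBr x y z : x ** (y - z) = x ** y - x ** z.
Proof. by rewrite cmulDr cmulNr. Qed.

Lemma cnorm_star x : `|star x| = `|x|.
Proof.
suff h y : `|y| <= `|star y|.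
  by apply/eqP; rewrite eq_le h andbT -{2}[x]starK h.
have [->|y0] := eqVneq y 0; first by rewrite normr0.
have y0' : 0 < `|y| by rewrite normr_gt0.
by rewrite -(ler_pM2r y0') -expr2 -cstar_identity ler_cnormM.
Qed.

Lemma cmul_eq0 x : (forall y, x ** y = 0) -> x = 0.
Proof.
move=> h; have := cstar_identity (star x).
by rewrite starK h normr0 cnorm_star => /esym/eqP; rewrite sqrf_eq0 normr_eq0
  => /eqP.
Qed.

Section limits.
Context {T : Type} {F : set_system T} {FF : ProperFilter F}.
Implicit Type f : T -> A.

Lemma cvg_cmull f x y : f @ F --> x -> (f t ** y) @[t --> F] --> x ** y.
Proof.
move=> /cvgrPdist_lt fx; apply/cvgrPdist_lt => e e0.
have y0 : 0 < `|y| + 1 by rewrite ltr_wpDl.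
have := fx (e / (`|y| + 1)) (divr_gt0 e0 y0); apply: filterS => t.
rewrite ltr_pdivlMr// => ht; rewrite -cmulBl (le_lt_trans (ler_cnormM _ _))//.
by rewrite (le_lt_trans _ ht)// ler_wpM2l// lerDl.
Qed.

Lemma cvg_cmulr f x y : f @ F --> x -> (y ** f t) @[t --> F] --> y ** x.
Proof.
move=> /cvgrPdist_lt fx; apply/cvgrPdist_lt => e e0.
have y0 : 0 < `|y| + 1 by rewrite ltr_wpDl.
have := fx (e / (`|y| + 1)) (divr_gt0 e0 y0); apply: filterS => t.
rewrite ltr_pdivlMr// => ht; rewrite -cmulBr (le_lt_trans (ler_cnormM _ _))//.
by rewrite (le_lt_trans _ ht)// mulrC ler_wpM2l// lerDl.
Qed.

Lemma cvg_dist_le f x y (K : R[i]) : f @ F --> x ->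
  (\forall t \near F, `|f t - y| <= K) -> `|x - y| <= K.
Proof.
move=> /cvgrPdist_lt fx fy; apply/ler_addgt0Pl => e e0.
near F => t; rewrite -(subrKA (f t)) (le_trans (ler_normD _ _))//.
by rewrite lerD//; [apply: ltW|]; near: t => //; exact: fx.
Unshelve. all: by end_near. Qed.

End limits.

End CStarTheory.

(* Double centralizers: m a and a m are written [lact m a] and [ract m a]. *)
Record multiplier (R : realType) (A : cstarAlgType R) := Multiplier {
  lact : A -> A;
  ract : A -> A;
  lact_linear : linear lact;
  ract_linear : linear ract;
  lact_bounded : exists M : R[i], forall a, `|lact a| <= M * `|a|;
  ract_bounded : exists M : R[i], forall a, `|ract a| <= M * `|a|;
  lactM : forall a b, lact (a ** b) = lact a ** b;
  ractM : forall a b, ract (a ** b) = a ** ract b;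
  ract_lact : forall a b, ract a ** b = a ** lact b
}.

HB.instance Definition _ (R : realType) (A : cstarAlgType R)
  (m : multiplier A) := GRing.isLinear.Build R[i] A A *:%R (lact m)
    (lact_linear m).
HB.instance Definition _ (R : realType) (A : cstarAlgType R)
  (m : multiplier A) := GRing.isLinear.Build R[i] A A *:%R (ract m)
    (ract_linear m).
HB.instance Definition _ (R : realType) (A : cstarAlgType R) :=
  gen_eqMixin (multiplier A).
HB.instance Definition _ (R : realType) (A : cstarAlgType R) :=
  gen_choiceMixin (multiplier A).

Section Multiplier.
Context {R : realType} {A : cstarAlgType R}.
Local Notation M := (multiplier A).
Local Obligation Tactic := idtac.
Implicit Types (m n p : M) (a b : A) (l : R[i]).

Lemma multiplierP m n : lact m =1 lact n -> m = n.
Proof.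
move=> h; have hl : lact m = lact n by apply/funext.
have hr : ract m = ract n.
  apply/funext => a; apply/eqP; rewrite -subr_eq0; apply/eqP/cmul_eq0 => b.
  by rewrite cmulBl !ract_lact h subrr.
case: m n hl hr {h} => lm rm + + + + + + + [ln rn + + + + + + +] /= hl hr.
rewrite -{ln}hl -{rn}hr => *.
by congr Multiplier; apply: Prop_irrelevance.
Qed.

Lemma multiplier_ubound m :
  {M : R[i] | [/\ 0 <= M, forall a, `|lact m a| <= M * `|a|
    & forall a, `|ract m a| <= M * `|a|]}.
Proof.
apply: cid; have [M1 h1] := lact_bounded m; have [M2 h2] := ract_bounded m.
have aux (f : A -> A) K : (forall a, `|f a| <= K * `|a|) ->
    forall a, `|f a| <= `|K| * `|a|.
  move=> h a; rewrite (le_trans (h a))//.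
  rewrite -(ger0_norm (le_trans (normr_ge0 _) (h a))).
  by rewrite normrM normr_id.
exists (`|M1| + `|M2|); split; first exact: addr_ge0.
  by move=> a; rewrite (le_trans (aux _ _ h1 a))// mulrDl lerDl mulr_ge0.
by move=> a; rewrite (le_trans (aux _ _ h2 a))// mulrDl lerDr mulr_ge0.
Qed.

Program Definition mzero : M :=
  @Multiplier R A (fun=> 0) (fun=> 0) _ _ _ _ _ _ _.
Next Obligation. by move=> l x y; rewrite scaler0 addr0. Qed.
Next Obligation. by move=> l x y; rewrite scaler0 addr0. Qed.
Next Obligation. by exists 0 => a; rewrite normr0 mul0r. Qed.
Next Obligation. by exists 0 => a; rewrite normr0 mul0r. Qed.
Next Obligation. by move=> x y /=; rewrite cmul0l. Qed.
Next Obligation. by move=> x y /=; rewrite cmul0r. Qed.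
Next Obligation. by move=> x y /=; rewrite cmul0r cmul0l. Qed.

Program Definition mopp m : M :=
  @Multiplier R A (fun a => - lact m a) (fun a => - ract m a) _ _ _ _ _ _ _.
Next Obligation. by move=> m l x y /=; rewrite linearP opprD scalerN. Qed.
Next Obligation. by move=> m l x y /=; rewrite linearP opprD scalerN. Qed.
Next Obligation.
move=> m /=.
by have [K hK] := lact_bounded m; exists K => a; rewrite normrN.
Qed.
Next Obligation.
move=> m /=.
by have [K hK] := ract_bounded m; exists K => a; rewrite normrN.
Qed.
Next Obligation. by move=> m x y /=; rewrite lactM cmulNl. Qed.
Next Obligation. by move=> m x y /=; rewrite ractM cmulNr. Qed.
Next Obligation. by move=> m x y /=; rewrite cmulNr cmulNl ract_lact. Qed.

Program Definition madd m n : M := @Multiplier R A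
  (fun a => lact m a + lact n a) (fun a => ract m a + ract n a) _ _ _ _ _ _ _.
Next Obligation. by move=> m n l x y /=; rewrite !linearP scalerDr addrACA. Qed.
Next Obligation. by move=> m n l x y /=; rewrite !linearP scalerDr addrACA. Qed.
Next Obligation.
move=> m n /=.
have [[K [_ hK _]] [K' [_ hK' _]]] := (multiplier_ubound m, multiplier_ubound n).
by exists (K + K') => a; rewrite mulrDl (le_trans (ler_normD _ _))// lerD.
Qed.
Next Obligation.
move=> m n /=.
have [[K [_ _ hK]] [K' [_ _ hK']]] := (multiplier_ubound m, multiplier_ubound n).
by exists (K + K') => a; rewrite mulrDl (le_trans (ler_normD _ _))// lerD.
Qed.
Next Obligation. by move=> m n x y /=; rewrite !lactM cmulDl. Qed.
Next Obligation. by move=> m n x y /=; rewrite !ractM cmulDr. Qed.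
Next Obligation. by move=> m n x y /=; rewrite cmulDl cmulDr !ract_lact. Qed.

Program Definition mscale l m : M := @Multiplier R A
  (fun a => l *: lact m a) (fun a => l *: ract m a) _ _ _ _ _ _ _.
Next Obligation.
move=> l m /=.
by move=> k x y; rewrite linearP scalerDr !scalerA mulrC.
Qed.
Next Obligation.
move=> l m /=.
by move=> k x y; rewrite linearP scalerDr !scalerA mulrC.
Qed.
Next Obligation.
move=> l m /=.
have [K [_ hK _]] := multiplier_ubound m; exists (`|l| * K) => a.
by rewrite normrZ -mulrA ler_wpM2l.
Qed.
Next Obligation.
move=> l m /=.
have [K [_ _ hK]] := multiplier_ubound m; exists (`|l| * K) => a.
by rewrite normrZ -mulrA ler_wpM2l.
Qed.
Next Obligation. by move=> l m x y /=; rewrite lactM cmulZl. Qed.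
Next Obligation. by move=> l m x y /=; rewrite ractM cmulZr. Qed.
Next Obligation. by move=> l m x y /=; rewrite cmulZl cmulZr ract_lact. Qed.

Program Definition mmul m n : M := @Multiplier R A
  (fun a => lact m (lact n a)) (fun a => ract n (ract m a)) _ _ _ _ _ _ _.
Next Obligation. by move=> m n l x y /=; rewrite !linearP. Qed.
Next Obligation. by move=> m n l x y /=; rewrite !linearP. Qed.
Next Obligation.
move=> m n /=.
have [[K [K0 hK _]] [K' [_ hK' _]]] :=
  (multiplier_ubound m, multiplier_ubound n).
by exists (K * K') => a; rewrite -mulrA (le_trans (hK _))// ler_wpM2l.
Qed.
Next Obligation.
move=> m n /=.
have [[K [K0 _ hK]] [K' [K'0 _ hK']]] :=
  (multiplier_ubound m, multiplier_ubound n).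
by exists (K' * K) => a; rewrite -mulrA (le_trans (hK' _))// ler_wpM2l.
Qed.
Next Obligation. by move=> m n x y /=; rewrite !lactM. Qed.
Next Obligation. by move=> m n x y /=; rewrite !ractM. Qed.
Next Obligation. by move=> m n x y /=; rewrite !ract_lact. Qed.

Program Definition mone : M := @Multiplier R A id id _ _ _ _ _ _ _.
Next Obligation. by []. Qed.
Next Obligation. by []. Qed.
Next Obligation. by exists 1 => a; rewrite mul1r. Qed.
Next Obligation. by exists 1 => a; rewrite mul1r. Qed.
Next Obligation. by []. Qed.
Next Obligation. by []. Qed.
Next Obligation. by []. Qed.

(* m^* a = (a^* m)^* and a m^* = (m a^* )^* *)
Program Definition mstar m : M := @Multiplier R A
  (fun a => star (ract m (star a))) (fun a => star (lact m (star a)))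
  _ _ _ _ _ _ _.
Next Obligation.
move=> m /=.
by move=> l x y; rewrite starD starZ linearP starD starZ conjCK.
Qed.
Next Obligation.
move=> m /=.
by move=> l x y; rewrite starD starZ linearP starD starZ conjCK.
Qed.
Next Obligation.
move=> m /=.
have [K [_ _ hK]] := multiplier_ubound m; exists K => a.
by rewrite cnorm_star -[`|a|]cnorm_star.
Qed.
Next Obligation.
move=> m /=.
have [K [_ hK _]] := multiplier_ubound m; exists K => a.
by rewrite cnorm_star -[`|a|]cnorm_star.
Qed.
Next Obligation. by move=> m x y /=; rewrite starM ractM starM starK. Qed.
Next Obligation. by move=> m x y /=; rewrite starM lactM starM starK. Qed.
Next Obligation.
move=> m x y /=.
by rewrite -{1}[y]starK -starM -ract_lact starM starK.
Qed.

Program Definition embed a : M := @Multiplier R A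
  (fun b => a ** b) (fun b => b ** a) _ _ _ _ _ _ _.
Next Obligation. by move=> a l x y /=; rewrite cmulDr cmulZr. Qed.
Next Obligation. by move=> a l x y /=; rewrite cmulDl cmulZl. Qed.
Next Obligation. by move=> a /=; exists `|a| => b; rewrite ler_cnormM. Qed.
Next Obligation. by move=> a /=; exists `|a| => b; rewrite mulrC ler_cnormM. Qed.
Next Obligation. by move=> a x y /=; rewrite cmulA. Qed.
Next Obligation. by move=> a x y /=; rewrite cmulA. Qed.
Next Obligation. by move=> a x y /=; rewrite cmulA. Qed.

Fact maddA : associative madd.
Proof. by move=> m n p; apply: multiplierP => a /=; rewrite addrA. Qed.
Fact maddC : commutative madd.
Proof. by move=> m n; apply: multiplierP => a /=; rewrite addrC. Qed.
Fact madd0 : left_id mzero madd.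
Proof. by move=> m; apply: multiplierP => a /=; rewrite add0r. Qed.
Fact maddN : left_inverse mzero mopp madd.
Proof. by move=> m; apply: multiplierP => a /=; rewrite addNr. Qed.


HB.instance Definition _ := GRing.isZmodule.Build M maddA maddC madd0 maddN.

Fact mscaleA l k m : mscale l (mscale k m) = mscale (l * k) m.
Proof. by apply: multiplierP => a /=; rewrite scalerA. Qed.
Fact mscale1 : left_id 1 mscale.
Proof. by move=> m; apply: multiplierP => a /=; rewrite scale1r. Qed.
Fact mscaleDr : right_distributive mscale +%R.
Proof. by move=> l m n; apply: multiplierP => a /=; rewrite scalerDr. Qed.
Fact mscaleDl m : {morph mscale^~ m : l k / l + k}.
Proof. by move=> l k; apply: multiplierP => a /=; rewrite scalerDl. Qed.

HB.instance Definition _ := GRing.Zmodule_isLmodule.Build R[i] M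
  mscaleA mscale1 mscaleDr mscaleDl.

Lemma lactD m n a : lact (m + n) a = lact m a + lact n a.
Proof. by []. Qed.
Lemma ractD m n a : ract (m + n) a = ract m a + ract n a.
Proof. by []. Qed.
Lemma lactN m a : lact (- m) a = - lact m a.
Proof. by []. Qed.
Lemma ractN m a : ract (- m) a = - ract m a.
Proof. by []. Qed.
Lemma lactZ l m a : lact (l *: m) a = l *: lact m a.
Proof. by []. Qed.
Lemma ractZ l m a : ract (l *: m) a = l *: ract m a.
Proof. by []. Qed.

(* The operator norm of [lact m]. *)
Definition mnorm m : R[i] :=
  (sup [set complex.Re `|lact m a| | a in [set a : A | `|a| <= 1]])%:C.

Lemma mnorm_has_sup m :
  has_sup [set complex.Re `|lact m a| | a in [set a : A | `|a| <= 1]].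
Proof.
split; first by exists (complex.Re `|lact m 0|), 0 => //=; rewrite normr0.
have [K [K0 hK _]] := multiplier_ubound m.
exists (complex.Re K) => _ [a /= a1 <-].
have : `|lact m a| <= K.
  by rewrite (le_trans (hK a))// -[leRHS]mulr1 ler_wpM2l.
by rewrite lecE => /andP[].
Qed.

Lemma mnorm_le m K : 0 <= K -> (forall a, `|lact m a| <= K * `|a|) ->
  mnorm m <= K.
Proof.
move=> K0 hK; rewrite -(RRe_real (ger0_real K0)) lecR.
apply: ge_sup => //; first by have [] := mnorm_has_sup m.
move=> _ [a /= a1 <-]; suff : `|lact m a| <= K by rewrite lecE => /andP[].
by rewrite (le_trans (hK a))// -[leRHS]mulr1 ler_wpM2l.
Qed.

Lemma ler_lact m a : `|lact m a| <= mnorm m * `|a|.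
Proof.
have [->|a0] := eqVneq a 0; first by rewrite linear0 !normr0 mulr0.
have a0' : 0 < `|a| by rewrite normr_gt0.
rewrite -ler_pdivrMr//.
have -> : `|lact m a| / `|a| = `|lact m (`|a|^-1 *: a)|.
  by rewrite linearZ normrZ mulrC ger0_norm// invr_ge0.
rewrite -(RRe_real (normr_real (lact m _))) lecR.
apply: ub_le_sup; first by have [] := mnorm_has_sup m.
by exists (`|a|^-1 *: a) => //=; rewrite normfZV.
Qed.

Lemma mnorm_ge0 m : 0 <= mnorm m.
Proof.
rewrite ler0c; have [_ hu] := mnorm_has_sup m.
apply: (ub_le_sup hu); exists 0; first by rewrite /= normr0.
by rewrite linear0 normr0.
Qed.

Fact ler_mnormD m n : mnorm (m + n) <= mnorm m + mnorm n.
Proof.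
apply: mnorm_le => [|a]; first by rewrite addr_ge0// mnorm_ge0.
by rewrite lactD mulrDl (le_trans (ler_normD _ _))// lerD// ler_lact.
Qed.

Fact mnormZ l m : mnorm (l *: m) = `|l| * mnorm m.
Proof.
have h k n : mnorm (k *: n) <= `|k| * mnorm n.
  apply: mnorm_le => [|a]; first by rewrite mulr_ge0// mnorm_ge0.
  by rewrite lactZ normrZ -mulrA ler_wpM2l// ler_lact.
apply/eqP; rewrite eq_le h/=.
have [->|l0] := eqVneq l 0; first by rewrite normr0 mul0r mnorm_ge0.
have l0' : 0 < `|l| by rewrite normr_gt0.
by rewrite -ler_pdivlMl// -normfV -{1}[m](scalerK l0) h.
Qed.

Fact mnorm0_eq0 m : mnorm m = 0 -> m = 0.
Proof.
move=> m0; apply: multiplierP => a /=; apply/eqP.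
by rewrite -normr_le0 -[leRHS](mul0r `|a|) -m0 ler_lact.
Qed.

HB.instance Definition _ := Lmodule_isNormed.Build R[i] M
  ler_mnormD mnormZ mnorm0_eq0.

Lemma normm_le m K : 0 <= K -> (forall a, `|lact m a| <= K * `|a|) ->
  `|m| <= K.
Proof. exact: mnorm_le. Qed.

Lemma ler_norm_lact m a : `|lact m a| <= `|m| * `|a|.
Proof. exact: ler_lact. Qed.

Fact mmulA : associative mmul.
Proof. by move=> m n p; apply: multiplierP. Qed.
Fact mmulDl : left_distributive mmul +%R.
Proof. by move=> m n p; apply: multiplierP. Qed.
Fact mmulDr : right_distributive mmul +%R.
Proof. by move=> m n p; apply: multiplierP => a /=; rewrite linearD. Qed.
Fact mmulZl l m n : mmul (l *: m) n = l *: mmul m n.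
Proof. exact: multiplierP. Qed.
Fact mmulZr l m n : mmul m (l *: n) = l *: mmul m n.
Proof. by apply: multiplierP => a /=; rewrite linearZ. Qed.
Fact ler_norm_mmul m n : `|mmul m n| <= `|m| * `|n|.
Proof.
apply: normm_le => [|a /=]; first by rewrite mulr_ge0.
by rewrite (le_trans (ler_norm_lact _ _))// -mulrA ler_wpM2l// ler_norm_lact.
Qed.
Fact mstarK : involutive mstar.
Proof. by move=> m; apply: multiplierP => a /=; rewrite !starK. Qed.
Fact mstarD : {morph mstar : m n / m + n}.
Proof. by move=> m n; apply: multiplierP => a /=; rewrite starD. Qed.
Fact mstarZ l m : mstar (l *: m) = (l^*)%R *: mstar m.
Proof. by apply: multiplierP => a /=; rewrite starZ. Qed.
Fact mstarM m n : mstar (mmul m n) = mmul (mstar n) (mstar m).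
Proof. by apply: multiplierP => a /=; rewrite starK. Qed.

Fact mcstar_identity m : `|mmul (mstar m) m| = `|m| ^+ 2.
Proof.
have h n : `|n| ^+ 2 <= `|mmul (mstar n) n|.
  set K := `|mmul _ _|; have K0 : 0 <= K by exact: normr_ge0.
  suff hn : `|n| <= sqrtC K.
    by rewrite -[leRHS]sqrtCK lerXn2r ?nnegrE ?sqrtC_ge0.
  apply: normm_le => [|a]; first by rewrite sqrtC_ge0.
  rewrite -(@ler_pXn2r _ 2)// ?nnegrE ?mulr_ge0 ?sqrtC_ge0//.
  rewrite exprMn sqrtCK -cstar_identity.
  have -> : star (lact n a) ** lact n a = star a ** lact (mmul (mstar n) n) a.
    by rewrite -(starK a) -[star (lact _ _)]/(ract (mstar n) (star a)) starK
      ract_lact.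
  rewrite (le_trans (ler_cnormM _ _))// cnorm_star mulrC expr2 mulrA.
  by rewrite ler_wpM2r// ler_norm_lact.
have hs n : `|n| <= `|mstar n|.
  have [->|n0] := eqVneq n 0; first by rewrite normr0.
  have n0' : 0 < `|n| by rewrite normr_gt0.
  by rewrite -(ler_pM2r n0') -expr2 (le_trans (h n))// ler_norm_mmul.
apply/eqP; rewrite eq_le h andbT (le_trans (ler_norm_mmul _ _))// expr2.
by rewrite ler_wpM2r// -{2}[m]mstarK hs.
Qed.

Lemma ler_norm_ract m a : `|ract m a| <= `|m| * `|a|.
Proof.
have -> : ract m a = star (lact (mstar m) (star a)) by rewrite /= !starK.
rewrite cnorm_star (le_trans (ler_norm_lact _ _))// cnorm_star ler_wpM2r//.
have [->|m0] := eqVneq (mstar m) 0; first by rewrite normr0.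
have m0' : 0 < `|mstar m| by rewrite normr_gt0.
rewrite -(ler_pM2r m0') -expr2 -mcstar_identity mstarK.
exact: ler_norm_mmul.
Qed.

Fact multiplier_complete (F : set_system M) :
  ProperFilter F -> cauchy F -> cvg F.
Proof.
move=> FF /cauchy_ballP Fc.
have Fnear (e : R[i]) : 0 < e ->
    \forall m \near F, \forall n \near F, `|m - n| < e.
  by move=> /Fc; rewrite -ball_normE => /nearP_dep.
have Fcvg (f : M -> A) (K : R[i]) : 0 <= K ->
    (forall m n, `|f m - f n| <= `|m - n| * K) -> cvg (f @ F).
  move=> K0 hf; apply/cauchy_cvgP/cauchy_exP => e e0.
  have K1 : 0 < K + 1 by rewrite ltr_wpDl.
  have [m hm] := filter_ex (Fnear _ (divr_gt0 e0 K1)).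
  exists (f m); apply: filterS hm => n; rewrite ltr_pdivlMr// => hn.
  rewrite -ball_normE /=; rewrite (le_lt_trans (hf _ _))//.
  by rewrite (le_lt_trans _ hn)// ler_wpM2l// lerDl.
have lcvg a : cvg (lact m a @[m --> F]).
  apply: (Fcvg _ `|a|) => // m n; rewrite -lactN -lactD; exact: ler_norm_lact.
have rcvg a : cvg (ract m a @[m --> F]).
  apply: (Fcvg _ `|a|) => // m n; rewrite -ractN -ractD; exact: ler_norm_ract.
pose L a := lim (lact m a @[m --> F]); pose Rr a := lim (ract m a @[m --> F]).
have lim_uniq (f g : M -> A) (x y : A) : f @ F --> x -> g @ F --> y -> f =1 g ->
    x = y.
  move=> fx gy /funext fg; rewrite fg in fx.
  exact: cvg_unique (@norm_hausdorff _ A) _ _ _ _ fx gy.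
have Ldist (e : R[i]) : 0 < e ->
    \forall m \near F, forall a, `|L a - lact m a| <= e * `|a|.
  move=> /Fnear; apply: filterS => m hm a; apply: cvg_dist_le (lcvg a) _.
  apply: filterS hm => n mn; rewrite -lactN -lactD.
  rewrite (le_trans (ler_norm_lact _ _))// ler_wpM2r// distrC; exact: ltW.
have Rdist (e : R[i]) : 0 < e ->
    \forall m \near F, forall a, `|Rr a - ract m a| <= e * `|a|.
  move=> /Fnear; apply: filterS => m hm a; apply: cvg_dist_le (rcvg a) _.
  apply: filterS hm => n mn; rewrite -ractN -ractD.
  rewrite (le_trans (ler_norm_ract _ _))// ler_wpM2r// distrC; exact: ltW.
have Llin : linear L.
  move=> l x y; apply: lim_uniq (lcvg _) (cvgD (cvgZr (lcvg x)) (lcvg y)) _ => m.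
  exact: linearP.
have Rlin : linear Rr.
  move=> l x y; apply: lim_uniq (rcvg _) (cvgD (cvgZr (rcvg x)) (rcvg y)) _ => m.
  exact: linearP.
have Lbnd : exists K : R[i], forall a, `|L a| <= K * `|a|.
  have [m hm] := filter_ex (Ldist 1 ltr01); exists (1 + `|m|) => a.
  rewrite -(subrK (lact m a) (L a)) (le_trans (ler_normD _ _))// mulrDl.
  by rewrite lerD// ler_norm_lact.
have Rbnd : exists K : R[i], forall a, `|Rr a| <= K * `|a|.
  have [m hm] := filter_ex (Rdist 1 ltr01); exists (1 + `|m|) => a.
  rewrite -(subrK (ract m a) (Rr a)) (le_trans (ler_normD _ _))// mulrDl.
  by rewrite lerD// ler_norm_ract.
have LM a b : L (a ** b) = L a ** b.
  have h : lact m a ** b @[m --> F] --> L a ** b by exact: cvg_cmull.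
  by apply: lim_uniq (lcvg _) h _ => m; exact: lactM.
have RM a b : Rr (a ** b) = a ** Rr b.
  have h : a ** ract m b @[m --> F] --> a ** Rr b by exact: cvg_cmulr.
  by apply: lim_uniq (rcvg _) h _ => m; exact: ractM.
have RL a b : Rr a ** b = a ** L b.
  have h1 : ract m a ** b @[m --> F] --> Rr a ** b by exact: cvg_cmull.
  have h2 : a ** lact m b @[m --> F] --> a ** L b by exact: cvg_cmulr.
  by apply: lim_uniq h1 h2 _ => m; exact: ract_lact.
apply/cvg_ex; exists (Multiplier Llin Rlin Lbnd Rbnd LM RM RL).
apply/fcvgrPdist_lt => e e0.
have e2 : 0 < e / 2 by rewrite divr_gt0.
apply: filterS (Ldist _ e2) => m hm.
rewrite (@le_lt_trans _ _ (e / 2))//; last first.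
  by rewrite ltr_pdivrMr// ltr_pMr// ltr1n.
apply: normm_le => [|a]; first exact: ltW.
by rewrite lactD lactN.
Qed.

HB.instance Definition _ := Uniform_isComplete.Build M multiplier_complete.

HB.instance Definition _ := isCStarAlgebra.Build R M mmulA mmulDl mmulDr
  mmulZl mmulZr ler_norm_mmul mstarK mstarD mstarZ mstarM mcstar_identity.

Lemma mul1m m : mone ** m = m.
Proof. exact: multiplierP. Qed.

Lemma mulm1 m : m ** mone = m.
Proof. exact: multiplierP. Qed.

Lemma embed_linear : linear (embed : A -> M).
Proof. by move=> l a b; apply: multiplierP => c /=; rewrite cmulDl cmulZl. Qed.

Lemma embedM a b : embed (a ** b) = embed a ** embed b.
Proof. by apply: multiplierP => c /=; rewrite cmulA. Qed.

Lemma embed_star a : embed (star a) = star (embed a).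
Proof. by apply: multiplierP => c /=; rewrite starM !starK. Qed.

Lemma embed_lact m a : embed (lact m a) = m ** embed a.
Proof. by apply: multiplierP => c /=; rewrite lactM. Qed.

Lemma embed_ract m a : embed (ract m a) = embed a ** m.
Proof. by apply: multiplierP => c /=; rewrite ract_lact. Qed.

Lemma norm_embed a : `|embed a| = `|a|.
Proof.
apply/eqP; rewrite eq_le normm_le//=; last by move=> b; exact: ler_cnormM.
have [->|a0] := eqVneq a 0; first by rewrite normr0.
have a0' : 0 < `|star a| by rewrite cnorm_star normr_gt0.
rewrite -(ler_pM2r a0') (le_trans _ (ler_norm_lact _ _))//=.
by have := cstar_identity (star a); rewrite starK => ->; rewrite expr2 cnorm_star.
Qed.

End Multiplier.

(* M(A) with the coarsest topology making m |-> m a and m |-> a m norm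
   continuous for every a in A. *)
Definition strict_multiplier (R : realType) (A : cstarAlgType R) : Type :=
  initial_topology (fun m : multiplier A =>
    (fun a => (lact m a, ract m a)) : {ptws A -> (A * A)%type}).

HB.instance Definition _ (R : realType) (A : cstarAlgType R) :=
  Topological.copy (strict_multiplier A)
    (initial_topology (fun m : multiplier A =>
      (fun a => (lact m a, ract m a)) : {ptws A -> (A * A)%type})).

Section StrictTopology.
Context {R : realType} {A : cstarAlgType R}.

Lemma strict_cvgP (F : set_system (strict_multiplier A))
    (m : strict_multiplier A) : Filter F ->
  F --> m <->
  forall a, lact n a @[n --> F] --> lact m a /\
            ract n a @[n --> F] --> ract m a.
Proof.
pose ev (n : multiplier A) : {ptws A -> (A * A)%type} :=
  fun a => (lact n a, ract n a).
move=> FF; have -> : F --> m <-> ev @ F --> (ev m : {ptws A -> (A * A)%type}).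
  split=> [Fm|Fm].
    by apply: cvg_trans (cvg_app _ Fm) _; exact: (@initial_continuous _ _ ev m).
  move=> P; rewrite nbhsE => -[_ [[B oB <-] Bm]] /filterS; apply.
  by apply: Fm; exact: open_nbhs_nbhs.
rewrite pointwise_cvgP; split=> h a.
  have ha := h a; split.
    exact: (cvg_comp _ _ ha (@cvg_fst _ _ _ _ _)).
  exact: (cvg_comp _ _ ha (@cvg_snd _ _ _ _ _)).
have [h1 h2] := h a; exact: cvg_pair h1 h2.
Qed.

Definition strictly_continuous (f : multiplier A -> multiplier A) :=
  continuous (f : strict_multiplier A -> strict_multiplier A).

Definition strict_extension (f : A -> A) (g : multiplier A -> multiplier A) :=
  strictly_continuous g /\ forall a, g (embed a) = embed (f a).

Definition extendible (f : A -> A) := exists g, strict_extension f g.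

End StrictTopology.

Section ExelSystem.
Context {R : realType} {A : cstarAlgType R}.
Implicit Types (a : A) (f alpha L : A -> A).

Definition endomorphism f :=
  [/\ linear f, {morph f : x y / x ** y} & {morph f : x / star x}].

Definition is_positive a := exists b, a = star b ** b.

Definition is_central a := forall b, a ** b = b ** a.

Definition positive_map f :=
  linear f /\ forall a, is_positive a -> is_positive (f a).

Definition transfer_operator alpha L :=
  positive_map L /\ forall a b, L (a ** alpha b) = L a ** b.

Definition Exel_system alpha L :=
  endomorphism alpha /\ transfer_operator alpha L.

End ExelSystem.

(* Main.v *)
From HB Require Import structures.
Require Import Defs.
From mathcomp Require Import all_boot all_order all_algebra.
From mathcomp Require Import complex.
From mathcomp Require Import all_classical all_reals all_analysis.
From mathcomp Require Import ring lra.

(* The extension is [m |-> (a |-> L (m alpha(a)))]: a positive map preserves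
   the involution and is bounded, so this is a double centralizer whose right
   action is [a |-> L (alpha(a) m)], and it depends strictly continuously on
   [m].  Since A has an approximate unit it is strictly dense in M(A), hence
   strictly continuous extensions are unique and inherit the algebraic
   identities.  Positivity of [Lbar m] follows from that of all the
   compressions [a^* Lbar(m) a = L (alpha(a)^* m alpha(a))].

   The order theory needed for this is obtained without spectral theory.  In
   the unital algebra M(A), square roots come from the iteration
   [z := (y + z^2) / 2], whose limit satisfies [(1 - z)^2 = 1 - y], and
   positivity of [c^* c] is Kelley and Vaught's theorem. *)

Set Implicit Arguments.
Unset Strict Implicit.
Unset Printing Implicit Defensive.

Import Order.TTheory GRing.Theory Num.Theory.
Import numFieldNormedType.Exports.

Local Open Scope classical_set_scope.
Local Open Scope ring_scope.
Local Open Scope complex_scope.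

(** * A decision procedure for identities in abelian groups *)

Inductive zmod_expr :=
  | ZVar of nat | ZZero | ZAdd of zmod_expr & zmod_expr | ZOpp of zmod_expr.

Section ZmodSolver.
Context {V : zmodType}.
Implicit Types (env : seq V) (e : zmod_expr).

Fixpoint zmod_eval env e : V :=
  match e with
  | ZVar i => env`_i
  | ZZero => 0
  | ZAdd e1 e2 => zmod_eval env e1 + zmod_eval env e2
  | ZOpp e1 => - zmod_eval env e1
  end.

Fixpoint zmod_coef e (i : nat) : int :=
  match e with
  | ZVar j => (i == j)%:Z
  | ZZero => 0
  | ZAdd e1 e2 => zmod_coef e1 i + zmod_coef e2 i
  | ZOpp e1 => - zmod_coef e1 i
  end.

Lemma zmod_eval_coef env e :
  zmod_eval env e = \sum_(i < size env) env`_i *~ zmod_coef e i.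
Proof.
elim: e => [j||e1 IH1 e2 IH2|e IH] /=; last first.
- by rewrite IH -sumrN; apply: eq_bigr => i _; rewrite mulrNz.
- by rewrite IH1 IH2 -big_split; apply: eq_bigr => i _; rewrite mulrzDr.
- by rewrite big1.
have [jn|nj] := ltnP j (size env).
  rewrite (bigD1 (Ordinal jn))//= eqxx mulr1z big1 ?addr0// => i.
  by rewrite -val_eqE /= => /negPf ->.
rewrite nth_default// big1// => i _.
by rewrite (_ : (val i == j) = false)// ltn_eqF// (leq_trans (ltn_ord i)).
Qed.

(** Reflection: the premise depends only on the syntax and the number of atoms, so it computes to
    [true] and [zmod] discharges it by [isT]. *)
Lemma zmod_evalP env e1 e2 :
  all (fun i => zmod_coef e1 i == zmod_coef e2 i) (iota 0 (size env)) ->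
  zmod_eval env e1 = zmod_eval env e2.
Proof.
move=> /allP h; rewrite !zmod_eval_coef; apply: eq_bigr => i _.
by rewrite (eqP (h i _))// mem_iota ltn_ord.
Qed.

End ZmodSolver.

(* Structural, since the same operation may be reached through different
   canonical structures. *)
Ltac zmod_same x y :=
  lazymatch constr:((x, y)) with
  | ((?a * ?b)%R, (?c * ?d)%R) => zmod_same a c; zmod_same b d
  | ((?k *: ?a)%R, (?l *: ?b)%R) => zmod_same k l; zmod_same a b
  | ((?a ^+ ?n)%R, (?b ^+ ?n)%R) => zmod_same a b
  | (star ?a, star ?b) => zmod_same a b
  | ((?a^-1)%R, (?b^-1)%R) => zmod_same a b
  | ((?a *+ ?n)%R, (?b *+ ?n)%R) => zmod_same a b
  | ((1)%R, (1)%R) => idtac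
  | ((?a + ?b)%R, (?c + ?d)%R) => zmod_same a c; zmod_same b d
  | ((- ?a)%R, (- ?b)%R) => zmod_same a b
  | _ => constr_eq_nounivs x y
  end.

(** The inner [match goal] runs [zmod_same] only for its success or failure, while the tactic still
    returns a term; failure backtracks to the next branch. *)
Ltac zmod_mem x l :=
  lazymatch l with
  | nil => constr:(false)
  | cons ?h ?t =>
    match goal with
    | _ => let _ := match goal with _ => zmod_same x h end in constr:(true)
    | _ => zmod_mem x t
    end
  end.

Ltac zmod_index x l :=
  lazymatch l with
  | cons ?h ?t =>
    match goal with
    | _ => let _ := match goal with _ => zmod_same x h end in constr:(O)
    | _ => let n := zmod_index x t in constr:(S n)
    end
  end.

Ltac zmod_atoms x l :=
  lazymatch x with
  | (?a + ?b)%R => let l1 := zmod_atoms a l in zmod_atoms b l1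
  | (- ?a)%R => zmod_atoms a l
  | (0)%R => l
  | _ => lazymatch zmod_mem x l with
         | true => l
         | false => constr:(cons x l)
         end
  end.

Ltac zmod_reify x l :=
  lazymatch x with
  | (?a + ?b)%R =>
    let ra := zmod_reify a l in let rb := zmod_reify b l in constr:(ZAdd ra rb)
  | (- ?a)%R => let ra := zmod_reify a l in constr:(ZOpp ra)
  | (0)%R => constr:(ZZero)
  | _ => let n := zmod_index x l in constr:(ZVar n)
  end.

Ltac zmod :=
  lazymatch goal with
  | |- @eq ?T ?a ?b =>
    let l0 := zmod_atoms a (@nil T) in
    let l := zmod_atoms b l0 in
    let ra := zmod_reify a l in
    let rb := zmod_reify b l in
    exact: (@zmod_evalP _ l ra rb isT)
  end.

Ltac ncexpand :=
  rewrite ?(mulrDl, mulrDr, mulNr, mulrN, mul1r, mulr1, mul0r, mulr0, opprK,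
            mulrA).

(** Once products are expanded without commuting factors, the monomials are the atoms of an identity
    in an abelian group. *)
Ltac ncring := ncexpand; zmod.

(** * Square roots *)

Section Limits.
Context {R : realType}.

(** Telescoping bounds [|u (N + k) - u N|] by [t (N + k) - t N], so [u] is Cauchy because [t] is. *)
Lemma cvg_dominated_increments (V : completeNormedModType R[i])
    (u : nat -> V) (t : nat -> R) :
  (forall n, `|u n.+1 - u n| <= (t n.+1 - t n)%:C) ->
  cvg (t @ \oo) -> cvg (u @ \oo).
Proof.
move=> ut tc; apply/cauchy_cvgP/cauchy_exP => e e0.
have er : e = (complex.Re e)%:C by rewrite RRe_real// ger0_real// ltW.
have e0' : 0 < complex.Re e by rewrite -ltcR -er.
have [N _ hN] : \forall n \near \oo, `|t n - lim (t @ \oo)| < complex.Re e / 2.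
  by move/cvgrPdistC_lt : tc; apply; rewrite divr_gt0.
have dist k : `|u (N + k)%N - u N| <= (t (N + k)%N - t N)%:C.
  elim: k => [|k IH]; first by rewrite addn0 !subrr normr0.
  rewrite addnS -(subrKA (u (N + k)%N)) (le_trans (ler_normD _ _))//.
  by rewrite -(subrKA (t (N + k)%N)) rmorphD lerD.
exists (u N); exists N => // n /= Nn; rewrite -ball_normE /= distrC.
rewrite -(subnKC Nn) (le_lt_trans (dist _))// er ltcR subnKC//.
rewrite (le_lt_trans (ler_norm _))// -(subrKA (lim (t @ \oo))).
rewrite (le_lt_trans (ler_normD _ _))// [ltRHS]splitr ltrD//.
  exact: hN.
by rewrite distrC; apply: hN => /=.
Qed.

(** The scalar case [y = 1] of the square root iteration; it dominates the iterates of every [y] of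
    norm at most 1. *)
Fixpoint sqrt_bound (n : nat) : R :=
  if n is k.+1 then (1 + sqrt_bound k ^+ 2) / 2 else 0.

Lemma sqrt_bound_itv n : 0 <= sqrt_bound n <= 1.
Proof.
elim: n => [|n /andP[h0 h1]] /=; first by rewrite lexx ler01.
have h2 : sqrt_bound n ^+ 2 <= 1 by rewrite expr_le1.
by rewrite divr_ge0 ?addr_ge0 ?exprn_ge0//= ler_pdivrMr// mul1r lerD.
Qed.

(** A term [t] is followed by the increment [(1 - t)^2 / 2], so the sequence increases; its limit
    solves [l = (1 + l^2) / 2], which forces [l = 1]. *)
Lemma cvg_sqrt_bound : sqrt_bound @ \oo --> (1 : R).
Proof.
have nd : nondecreasing_seq sqrt_bound.
  apply/nondecreasing_seqP => n /=; rewrite ler_pdivlMr// -subr_ge0.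
  have -> : 1 + sqrt_bound n ^+ 2 - sqrt_bound n * 2 = (1 - sqrt_bound n) ^+ 2.
    by rewrite sqrrB expr1n mul1r mulr_natr addrAC.
  exact: sqr_ge0.
have /cvg_ex[l hl] : cvg (sqrt_bound @ \oo).
  apply: nondecreasing_is_cvgn => //; exists 1 => _ [n _ <-].
  by have /andP[] := sqrt_bound_itv n.
have hl1 : (sqrt_bound n.+1) @[n --> \oo] --> l by rewrite -cvg_shiftS in hl.
have hl2 : (sqrt_bound n.+1) @[n --> \oo] --> (1 + l ^+ 2) / 2.
  by apply: cvgM; [apply: cvgD; [exact: cvg_cst|rewrite expr2; exact: cvgM]
                  |exact: cvg_cst].
have e := cvg_unique (@norm_hausdorff _ _) hl1 hl2.
have /eqP : (l - 1) ^+ 2 = 2 * ((1 + l ^+ 2) / 2) - 2 * l by field.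
by rewrite -e subrr sqrf_eq0 subr_eq0 => /eqP <-.
Qed.

Lemma cvg_sub_sqrt_bound (V : normedModType R[i]) (v : V) :
  ((1 - sqrt_bound n)%:C *: v) @[n --> \oo] --> (0 : V).
Proof.
apply/cvgr0Pnorm_lt => e e0.
have er : e = (complex.Re e)%:C by rewrite RRe_real// ger0_real// ltW.
have e0' : 0 < complex.Re e by rewrite -ltcR -er.
have vr : `|v| = (complex.Re `|v|)%:C by rewrite RRe_real// normr_real.
have v0 : 0 < complex.Re `|v| + 1 by rewrite ltr_wpDl// -ler0c -vr.
have /cvgrPdist_lt/(_ _ (divr_gt0 e0' v0)) := cvg_sqrt_bound.
apply: filterS => n; have /andP[_ h1] := sqrt_bound_itv n.
rewrite er normrZ vr !ger0_norm ?ler0c ?subr_ge0// ltr_pdivlMr//.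
rewrite -rmorphM ltcR; apply: le_lt_trans.
by rewrite ler_wpM2l ?subr_ge0// lerDl.
Qed.

End Limits.

(** * The multiplier algebra as a ring *)

HB.instance Definition _ (R : realType) (A : cstarAlgType R) :=
  GRing.Zmodule_isPzRing.Build (multiplier A)
    mmulA mul1m mulm1 mmulDl mmulDr.

Section MultiplierRing.
Context {R : realType} {A : cstarAlgType R}.
Local Notation M := (multiplier A).
Implicit Types (x y z c : M) (l : R[i]).

Lemma mmulE x y : x ** y = x * y. Proof. by []. Qed.

Lemma mscaleAl l x y : l *: (x * y) = (l *: x) * y.
Proof. by rewrite -!mmulE cmulZl. Qed.

Lemma mscaleAr l x y : l *: (x * y) = x * (l *: y).
Proof. by rewrite -!mmulE cmulZr. Qed.

Lemma ler_mnormM x y : `|x * y| <= `|x| * `|y|.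
Proof. exact: ler_cnormM. Qed.

Lemma ler_norm1 : `|1 : M| <= 1.
Proof. by apply: normm_le => // a; rewrite mul1r. Qed.

Lemma mstar_mul x y : star (x * y) = star y * star x.
Proof. exact: starM. Qed.

Lemma star1 : star (1 : M) = 1.
Proof. by apply: multiplierP => a /=; rewrite starK. Qed.

Lemma star0 (B : cstarAlgType R) : star (0 : B) = 0.
Proof. by rewrite -(scale0r (0 : B)) starZ conj_Creal ?real0// !scale0r. Qed.

Lemma starN (B : cstarAlgType R) (b : B) : star (- b) = - star b.
Proof. by rewrite -scaleN1r starZ conj_Creal ?realN ?real1// scaleN1r. Qed.

Lemma starB (B : cstarAlgType R) (b d : B) : star (b - d) = star b - star d.
Proof. by rewrite starD starN. Qed.

Lemma star_scaler (B : cstarAlgType R) l (b : B) : 0 <= l ->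
  star (l *: b) = l *: star b.
Proof. by move=> l0; rewrite starZ conj_Creal// ger0_real. Qed.

Lemma starX x n : star (x ^+ n) = star x ^+ n.
Proof.
elim: n => [|n IH]; first exact: star1.
by rewrite exprS mstar_mul IH -exprSr.
Qed.

Lemma norm_sqr x : star x = x -> `|x * x| = `|x| ^+ 2.
Proof. by move=> xs; rewrite -cstar_identity xs. Qed.

Lemma cvg_star (B : cstarAlgType R) (T : Type) (F : set_system T)
    {FF : Filter F} (f : T -> B) (b : B) :
  f @ F --> b -> star (f t) @[t --> F] --> star b.
Proof.
move=> /cvgrPdist_lt h; apply/cvgrPdist_lt => e /h; apply: filterS => t.
by rewrite -starB cnorm_star.
Qed.

Lemma cvg_norm_unique (V : normedModType R[i]) (T : Type) (F : set_system T)
    {FF : ProperFilter F} (f : T -> V) (u v : V) :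
  f @ F --> u -> f @ F --> v -> u = v.
Proof. by move=> h1 h2; apply: (cvg_unique (@norm_hausdorff _ V) h1 h2). Qed.

Lemma cvg_selfadjoint (f : nat -> M) x : f @ \oo --> x ->
  (forall n, star (f n) = f n) -> star x = x.
Proof.
move=> fx fs; have h : star (f n) @[n --> \oo] --> star x by exact: cvg_star.
have e : (fun n => star (f n)) = f by apply/funext => n; exact: fs.
by rewrite e in h; exact: (cvg_norm_unique h fx).
Qed.

Lemma cvg_comm (f : nat -> M) x c : f @ \oo --> x ->
  (forall n, c * f n = f n * c) -> c * x = x * c.
Proof.
move=> fx h.
have h1 : f n ** c @[n --> \oo] --> x ** c by exact: cvg_cmull.
have h2 : c ** f n @[n --> \oo] --> c ** x by exact: cvg_cmulr.
have e : (fun n => c ** f n) = (fun n => f n ** c) by apply/funext => n; exact: h.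
by rewrite e in h2; exact: (cvg_norm_unique h2 h1).
Qed.

Lemma embedD a b : embed (a + b) = embed a + embed b :> M.
Proof. by rewrite -[a]scale1r embed_linear !scale1r. Qed.

Lemma embed0 : embed 0 = 0 :> M.
Proof. by apply: multiplierP => c /=; rewrite cmul0l. Qed.

Lemma embedZ l a : embed (l *: a) = l *: embed a :> M.
Proof. by rewrite -[l *: a]addr0 embed_linear embed0 addr0. Qed.

Lemma embedN a : embed (- a) = - embed a :> M.
Proof. by rewrite -scaleN1r embedZ scaleN1r. Qed.

Lemma embedB a b : embed (a - b) = embed a - embed b :> M.
Proof. by rewrite embedD embedN. Qed.

(** A is closed in M(A): it is complete and [embed] is isometric. *)
Lemma cvg_embed (f : nat -> M) x : f @ \oo --> x ->
  (forall n, exists a, f n = embed a) -> exists a, x = embed a.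
Proof.
move=> fx /choice[g fg].
have /cvg_ex[a ga] : cvg (g @ \oo).
  apply/cauchy_cvgP/cauchy_exP => e e0.
  have e2 : 0 < e / 2 by rewrite divr_gt0.
  have /cvgrPdistC_lt/(_ _ e2)[N _ hN] := fx.
  exists (g N); exists N => // n /= Nn; rewrite -ball_normE /=.
  rewrite -norm_embed embedB -!fg -(subrKA x) (le_lt_trans (ler_normD _ _))//.
  rewrite [ltRHS]splitr ltrD//; first by apply: hN => /=.
  by rewrite distrC; apply: hN.
exists a; apply: (cvg_norm_unique fx).
apply/cvgrPdist_lt => e; move/cvgrPdist_lt : ga => /[apply].
by apply: filterS => n; rewrite fg -embedB norm_embed.
Qed.

End MultiplierRing.

(** * The square root of [1 - y] by iteration *)

Section SquareRoot.
Context {R : realType} {A : cstarAlgType R}.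
Local Notation M := (multiplier A).
Variable y : M.
Hypothesis y1 : `|y| <= 1.
Local Notation t := (@sqrt_bound R).

Fixpoint sqrt_iter (n : nat) : M :=
  if n is k.+1 then 2^-1 *: (y + sqrt_iter k * sqrt_iter k) else 0.

Definition sqrt_one_minus : M := 1 - lim (sqrt_iter @ \oo).

Lemma norm_sqrt_iter n : `|sqrt_iter n| <= (t n)%:C.
Proof.
elim: n => [|n IH] /=; first by rewrite normr0.
rewrite normrZ ger0_norm ?invr_ge0// rmorphM rmorphD rmorph1 rmorphXn fmorphV.
rewrite rmorph_nat mulrC ler_pM2r ?invr_gt0// (le_trans (ler_normD _ _))//.
rewrite lerD// (le_trans (ler_mnormM _ _))// expr2 ler_pM//.
Qed.

(** The splitting [a a - b b = a (a - b) + (a - b) b] needs no commutation, and the scalar majorant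
    satisfies the analogous recursion with equality. *)
Lemma sqrt_iter_increment n :
  `|sqrt_iter n.+1 - sqrt_iter n| <= (t n.+1 - t n)%:C.
Proof.
elim: n => [|n IH].
  rewrite /= subr0 mul0r addr0 subr0 expr0n/= addr0 normrZ.
  by rewrite ger0_norm ?invr_ge0// mul1r fmorphV rmorph_nat ler_piMr ?invr_ge0.
rewrite [sqrt_iter n.+2]/= [in X in _ - X]/= -scalerBr opprD addrACA subrr add0r.
rewrite -/(sqrt_iter n.+1) normrZ ger0_norm ?invr_ge0//.
have -> : t n.+2 - t n.+1 = 2^-1 * ((t n.+1 + t n) * (t n.+1 - t n)).
  by rewrite /=; field.
rewrite rmorphM fmorphV rmorph_nat ler_pM2l ?invr_gt0//.
set a := sqrt_iter n.+1 in IH *; set b := sqrt_iter n in IH *.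
have -> : a * a - b * b = a * (a - b) + (a - b) * b.
  by rewrite mulrBr mulrBl subrKA.
rewrite (le_trans (ler_normD _ _))// rmorphM (rmorphD _ (t n.+1)).
rewrite [leRHS]mulrDl lerD//.
  by rewrite (le_trans (ler_mnormM _ _))// ler_pM// norm_sqrt_iter.
by rewrite mulrC (le_trans (ler_mnormM _ _))// ler_pM// norm_sqrt_iter.
Qed.

Lemma cvg_sqrt_iter : cvg (sqrt_iter @ \oo).
Proof.
apply: cvg_dominated_increments sqrt_iter_increment _.
by apply: cvgP; exact: cvg_sqrt_bound.
Qed.

Lemma cvg_sqrt_one_minus : (1 - sqrt_iter n) @[n --> \oo] --> sqrt_one_minus.
Proof. by apply: cvgB; [exact: cvg_cst|exact: cvg_sqrt_iter]. Qed.

Lemma sqrt_one_minusK : sqrt_one_minus * sqrt_one_minus = 1 - y.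
Proof.
set z := lim (sqrt_iter @ \oo).
have hz : sqrt_iter @ \oo --> z := cvg_sqrt_iter.
have z1 n : `|sqrt_iter n| <= 1.
  rewrite (le_trans (norm_sqrt_iter n))// -(rmorph1 (real_complex R)) lecR.
  by have /andP[] := sqrt_bound_itv (R := R) n.
have hz1 : `|z| <= 1.
  rewrite -[z]subr0; apply: cvg_dist_le hz _.
  by apply: nearW => n; rewrite subr0; exact: z1.
have hzz : (sqrt_iter n * sqrt_iter n) @[n --> \oo] --> z * z.
  apply/cvgrPdist_lt => e e0.
  have e2 : 0 < e / 2 by rewrite divr_gt0.
  have /cvgrPdist_lt/(_ _ e2) := hz; apply: filterS => n.
  rewrite ltr_pdivlMr// => ze; apply: le_lt_trans ze.
  set b := sqrt_iter n.
  have -> : z * z - b * b = z * (z - b) + (z - b) * b.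
    by rewrite mulrBr mulrBl subrKA.
  rewrite mulr_natr mulr2n (le_trans (ler_normD _ _))// lerD//.
    by rewrite (le_trans (ler_mnormM _ _))// ler_piMl.
  by rewrite (le_trans (ler_mnormM _ _))// ler_piMr//; exact: z1.
have h1 : sqrt_iter n.+1 @[n --> \oo] --> z by rewrite -cvg_shiftS in hz.
have h2 : sqrt_iter n.+1 @[n --> \oo] --> 2^-1 *: (y + z * z).
  by apply: cvgZr; apply: cvgD => //; exact: cvg_cst.
have e : z = 2^-1 *: (y + z * z) by exact: (cvg_norm_unique h1 h2).
rewrite /sqrt_one_minus -/z mulrBr mulr1 mulrBl mul1r opprB.
have -> : z * z = 2 *: z - y.
  by rewrite {3}e scalerA divff// scale1r addrC addKr.
by rewrite scaler_nat mulr2n [X in _ + X]addrAC addrK subrKA.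
Qed.

Lemma sqrt_iter_star : star y = y -> forall n, star (sqrt_iter n) = sqrt_iter n.
Proof.
move=> ys; elim=> [|n IH] /=; first exact: star0.
by rewrite star_scaler ?invr_ge0// starD ys mstar_mul IH.
Qed.

Lemma star_sqrt_one_minus : star y = y -> star sqrt_one_minus = sqrt_one_minus.
Proof.
move=> /sqrt_iter_star ys; apply: cvg_selfadjoint cvg_sqrt_one_minus _ => n.
by rewrite starB star1 ys.
Qed.

Lemma sqrt_iter_comm c : c * y = y * c ->
  forall n, c * sqrt_iter n = sqrt_iter n * c.
Proof.
move=> cy; elim=> [|n IH] /=; first by rewrite mulr0 mul0r.
by rewrite -mscaleAl -mscaleAr mulrDl mulrDr cy -mulrA -IH !mulrA IH.
Qed.

Lemma sqrt_one_minus_comm c : c * y = y * c ->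
  c * sqrt_one_minus = sqrt_one_minus * c.
Proof.
move=> /sqrt_iter_comm cy; apply: cvg_comm cvg_sqrt_one_minus _ => n.
by rewrite mulrBl mulrBr cy mul1r mulr1.
Qed.

(* Modulo A the iterates are the scalars [t n], which tend to 1. *)
Lemma sqrt_iter_embed a : 1 - y = embed a ->
  forall n, exists b : A, sqrt_iter n = (t n)%:C *: (1 : M) + embed b.
Proof.
move=> ya; elim=> [|n [b hb]]; first by exists 0; rewrite embed0 scale0r addr0.
(* With [s = t n], half of [1 - a + (s + b)^2] has scalar part [t n.+1]; the witness is what
   remains. *)
exists (2^-1 *: (b ** b - a) + (t n)%:C *: b).
rewrite embedD !embedZ embedB embedM -ya /= hb mmulE.
set s := (t n)%:C; set E := embed b.
have -> : ((1 + t n ^+ 2) / 2)%:C = 2^-1 * (1 + s ^+ 2).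
  rewrite /s -rmorphXn -(rmorph_nat (real_complex R)) -fmorphV.
  by rewrite -(rmorph1 (real_complex R)) -rmorphD -rmorphM; congr (_%:C); field.
have -> : y + (s *: (1 : M) + E) * (s *: (1 : M) + E) =
    (1 + s ^+ 2) *: (1 : M) + (E * E - (1 - y)) + 2 *: (s *: E).
  rewrite mulrDl !mulrDr -!mscaleAl -!mscaleAr !mul1r mulr1 scalerA -expr2.
  rewrite scaler_nat mulr2n scalerDl scale1r.
  zmod.
rewrite 2!scalerDr !scalerA mulKf//.
zmod.
Qed.

(** Subtracting the scalar [1 - t n], which tends to 0, moves [1 - sqrt_iter n] into A without
    changing the limit, and A is closed. *)
Lemma sqrt_one_minus_embed a : 1 - y = embed a ->
  exists b, sqrt_one_minus = embed b.
Proof.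
move=> /sqrt_iter_embed ya.
have h : ((1 - sqrt_iter n) - (1 - t n)%:C *: (1 : M)) @[n --> \oo] -->
    sqrt_one_minus.
  rewrite -[sqrt_one_minus]subr0; apply: cvgB; first exact: cvg_sqrt_one_minus.
  exact: cvg_sub_sqrt_bound.
apply: (cvg_embed h) => n; have [b ->] := ya n.
exists (- b); have -> : (1 - t n)%:C = 1 - (t n)%:C by exact: rmorphB.
rewrite scalerBl scale1r embedN; zmod.
Qed.

End SquareRoot.
(** * Positive elements *)

Section Positivity.
Context {R : realType} {A : cstarAlgType R}.
Local Notation M := (multiplier A).
Implicit Types (h k p r x y z c : M) (l t : R[i]).

Lemma selfadj_sqr x : star x = x -> star (x * x) = x * x.
Proof. by move=> xs; rewrite mstar_mul xs. Qed.

Lemma norm_scale1_le t : 0 <= t -> `|t *: (1 : M)| <= t.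
Proof. by move=> t0; rewrite normrZ ger0_norm// ler_piMr// ler_norm1. Qed.

(* [p + i r] is normal with real part [p]. *)
Lemma ler_norm_sqrD p r : star p = p -> star r = r -> p * r = r * p ->
  `|p * p| <= `|p * p + r * r|.
Proof.
move=> ps rs pr; set w := p + 'i *: r.
have ws : star w = p - 'i *: r.
  by rewrite /w starD starZ ps rs conjCi scaleNr.
have ww : star w * w = p * p + r * r.
  have ii : 'i * 'i = -1 :> R[i] by rewrite -expr2 sqrCi.
  rewrite ws /w mulrDr !mulrBl -!mscaleAl -!mscaleAr !scalerA ii.
  rewrite pr scaleN1r; zmod.
have pw : `|p| <= `|w|.
  have -> : p = 2^-1 *: (w + star w).
    have -> : w + star w = 2 *: p by rewrite scaler_nat mulr2n ws /w; zmod.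
    by rewrite scalerA mulVf// scale1r.
  rewrite normrZ ger0_norm ?invr_ge0// ler_pdivrMl// [leRHS]mulr_natl mulr2n.
  by rewrite (le_trans (ler_normD _ _))// cnorm_star.
by rewrite norm_sqr// -ww -mmulE cstar_identity lerXn2r ?nnegrE.
Qed.

(** The root [s] of [1 - k^2] commutes with [k], so the norm of [s^2] is at most that of
    [s^2 + k^2 = 1]. *)
Lemma norm_one_minus_sqr k : star k = k -> `|k| <= 1 -> `|1 - k * k| <= 1.
Proof.
move=> ks k1; have kk1 : `|k * k| <= 1 by rewrite norm_sqr// expr_le1.
have kks := selfadj_sqr ks.
rewrite -sqrt_one_minusK//; set s := sqrt_one_minus _.
have ss : star s = s by exact: star_sqrt_one_minus.
have sk : s * k = k * s.
  by apply/esym; apply: sqrt_one_minus_comm => //; rewrite mulrA.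
rewrite (le_trans (ler_norm_sqrD ss ks sk))// sqrt_one_minusK// subrK.
exact: ler_norm1.
Qed.

(* For selfadjoint [h] this says that the spectrum of [h] lies in [[0, 2t]]. *)
Definition psd h :=
  star h = h /\ exists2 t : R[i], 0 <= t & `|t *: (1 : M) - h| <= t.

(** Dividing [k] by the square root of [t] reduces this to [norm_one_minus_sqr]. *)
Lemma psd_sqr_bound k t :
  star k = k -> `|k * k| <= t -> `|t *: (1 : M) - k * k| <= t.
Proof.
move=> ks kt; have t0 : 0 <= t by rewrite (le_trans _ kt).
have [te|tn] := eqVneq t 0; first by move: kt; rewrite te scale0r add0r normrN.
have t0' : 0 < t by rewrite lt_def tn.
have st0 : 0 < sqrtC t by rewrite sqrtC_gt0.
have st1 := ltW st0; set k' := (sqrtC t)^-1 *: k.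
have k's : star k' = k' by rewrite star_scaler ?invr_ge0// ks.
have k1 : `|k'| <= 1.
  rewrite normrZ ger0_norm ?invr_ge0// ler_pdivrMl// mulr1.
  rewrite -(@ler_pXn2r _ 2)// ?nnegrE//// sqrtCK.
  by rewrite -norm_sqr.
have -> : t *: (1 : M) - k * k = t *: (1 - k' * k').
  have e : (sqrtC t)^-1 * (sqrtC t)^-1 = t^-1 by rewrite -invfM -expr2 sqrtCK.
  rewrite /k' -mscaleAl -mscaleAr scalerA e scalerBr scalerA divff//.
  by rewrite scale1r.
by rewrite normrZ ger0_norm// ler_piMr// norm_one_minus_sqr.
Qed.

Lemma psd_sqr k : star k = k -> psd (k * k).
Proof.
move=> ks; split; first exact: selfadj_sqr.
by exists `|k * k| => //; exact: psd_sqr_bound.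
Qed.

(** For a [t] witnessing [psd h], the root is [sqrtC t] times the root of [h / t = 1 - y]. The last
    two clauses make roots of commuting elements commute and keep roots of elements of A in A. *)
Lemma psd_sqrt h : psd h -> exists r, [/\ star r = r, r * r = h,
  forall c, c * h = h * c -> c * r = r * c
  & forall a, h = embed a -> exists b, r = embed b].
Proof.
move=> [hs [t t0 ht]].
have [te|tn] := eqVneq t 0.
  have -> : h = 0.
    by apply/eqP; rewrite -normr_le0; move: ht; rewrite te scale0r add0r normrN.
  exists 0; split => [||c|a _]; rewrite ?mulr0 ?mul0r ?star0//.
  by exists 0; rewrite embed0.
have t0' : 0 < t by rewrite lt_def tn.
set y := 1 - t^-1 *: h.
have yE : y = t^-1 *: (t *: (1 : M) - h).
  by rewrite scalerBr scalerA mulVf// scale1r.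
have y1 : `|y| <= 1.
  by rewrite yE normrZ ger0_norm ?invr_ge0// ler_pdivrMl// mulr1.
have ys : star y = y by rewrite /y starB star1 star_scaler ?invr_ge0// hs.
have yh : 1 - y = t^-1 *: h by rewrite /y; zmod.
exists (sqrtC t *: sqrt_one_minus y); split => [||c ch|a ha].
- by rewrite star_scaler ?sqrtC_ge0// star_sqrt_one_minus.
- rewrite -mscaleAl -mscaleAr scalerA -expr2 sqrtCK sqrt_one_minusK// yh.
  by rewrite scalerA divff// scale1r.
- rewrite -mscaleAl -mscaleAr sqrt_one_minus_comm//.
  by rewrite /y mulrBl mulrBr mul1r mulr1 -mscaleAl -mscaleAr ch.
- have [|b hb] := @sqrt_one_minus_embed _ _ _ y1 (t^-1 *: a).
    by rewrite yh ha embedZ.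
  by exists (sqrtC t *: b); rewrite embedZ hb.
Qed.

(** [psd] provides a single [t]; writing [h] as a square upgrades this to every [t] above the
    norm. *)
Lemma psd_bound h t : psd h -> `|h| <= t -> `|t *: (1 : M) - h| <= t.
Proof. by move=> /psd_sqrt[r [rs <- _ _]]; exact: psd_sqr_bound. Qed.

Lemma psd0 : psd 0.
Proof. by rewrite -(mulr0 0); apply: psd_sqr; exact: star0. Qed.

Lemma psdD h k : psd h -> psd k -> psd (h + k).
Proof.
move=> [hs [t t0 ht]] [ks [s s0 hk]]; split; first by rewrite starD hs ks.
exists (t + s); first exact: addr_ge0.
rewrite scalerDl opprD addrACA (le_trans (ler_normD _ _))// lerD//.
Qed.

Lemma psdZ l h : 0 <= l -> psd h -> psd (l *: h).
Proof.
move=> l0 [hs [t t0 ht]]; split; first by rewrite star_scaler// hs.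
exists (l * t); first exact: mulr_ge0.
by rewrite -scalerA -scalerBr normrZ ger0_norm// ler_wpM2l.
Qed.

Lemma psdMn h n : psd h -> psd (h *+ n).
Proof. by move=> h0; rewrite -scaler_nat; apply: psdZ. Qed.

(** The constant [|h| + 1] eventually exceeds the norms of the [f n], so by [psd_bound] it serves as
    a common [t], also in the limit. *)
Lemma psd_cvg (f : nat -> M) h :
  f @ \oo --> h -> (forall n, psd (f n)) -> psd h.
Proof.
move=> fh f0; split; first by apply: cvg_selfadjoint fh _ => n; case: (f0 n).
have t0 : 0 <= `|h| + 1 by rewrite addr_ge0.
exists (`|h| + 1) => //.
have tf : (`|h| + 1) *: (1 : M) - f n @[n --> \oo] --> (`|h| + 1) *: (1 : M) - h.
  by apply: cvgB => //; exact: cvg_cst.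
rewrite -[X in `|X|]subr0; apply: cvg_dist_le tf _.
have /cvgrPdistC_lt/(_ _ ltr01) := fh; apply: filterS => n fn.
rewrite subr0; apply: psd_bound => //.
rewrite -(subrK h (f n)) (le_trans (ler_normD _ _))// addrC lerD2l.
exact: ltW.
Qed.

(** As [k] commutes with [h] it commutes with the root [r], and then [r] commutes with the root [s];
    hence [h k = (r s)^2]. *)
Lemma psdM h k : psd h -> psd k -> h * k = k * h -> psd (h * k).
Proof.
move=> /psd_sqrt[r [rs <- hr _]] /psd_sqrt[s [ss <- hs _]] e.
have e1 : r * s = s * r.
  apply: hs; apply/esym; apply: hr; exact/esym.
have -> : r * r * (s * s) = (r * s) * (r * s).
  by rewrite -[RHS]mulrA [s * (r * s)]mulrA -e1 !mulrA.
by apply: psd_sqr; rewrite mstar_mul rs ss.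
Qed.

Lemma psd_one_minus h : star h = h -> `|h| <= 1 -> psd (1 - h).
Proof.
move=> hs h1; split; first by rewrite starB star1 hs.
by exists 1 => //; rewrite scale1r opprB addrCA subrr addr0.
Qed.

Lemma psd_scale1_sub h t : star h = h -> `|h| <= t -> psd (t *: (1 : M) - h).
Proof.
move=> hs ht; have t0 : 0 <= t by exact: le_trans ht.
split; first by rewrite starB star_scaler// star1 hs.
by exists t => //; rewrite opprB addrCA subrr addr0.
Qed.

(** For commuting roots [p] of [h] and [r] of [t - h], [ler_norm_sqrD] compares [p^2] with
    [p^2 + r^2 = t]. *)
Lemma psd_norm_le h t : 0 <= t -> psd h -> psd (t *: (1 : M) - h) -> `|h| <= t.
Proof.
move=> t0 /psd_sqrt[p [ps ph hp _]] /psd_sqrt[r [rs rh hr _]].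
have pr : p * r = r * p.
  apply: hr; rewrite mulrBl mulrBr -mscaleAl -mscaleAr mul1r mulr1.
  by rewrite -ph mulrA.
rewrite -ph (le_trans (ler_norm_sqrD ps rs pr))// rh ph addrC subrK.
exact: norm_scale1_le.
Qed.

Lemma psd_ler_normD h k : psd h -> psd k -> `|h| <= `|h + k|.
Proof.
move=> h0 k0; apply: psd_norm_le => //.
have -> : `|h + k| *: (1 : M) - h = (`|h + k| *: (1 : M) - (h + k)) + k by zmod.
by apply: psdD => //; apply: psd_scale1_sub => //; case: (psdD h0 k0).
Qed.

(** * Absolute values of selfadjoint elements *)

Section Absolute.
Variable x : M.
Hypotheses (xs : star x = x) (x1 : `|x| <= 1).

(** [1 - x^2] is positive, and the recursion only adds, squares and rescales by a positive
    scalar. *)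
Lemma psd_sqrt_iter n : psd (sqrt_iter (1 - x * x) n).
Proof.
elim: n => [|n IH] /=; first exact: psd0.
apply: psdZ; rewrite ?invr_ge0//; apply: psdD.
  apply: psd_one_minus; first exact: selfadj_sqr.
  by rewrite norm_sqr// expr_le1.
by apply: psdM.
Qed.

(* [1 - z_(n+1) - x = (1 - z_n - x) (z_n + (1 - x)) / 2] *)
Lemma psd_sqrt_iter_sub n : psd (1 - sqrt_iter (1 - x * x) n - x).
Proof.
elim: n => [|n IH]; first by rewrite subr0; exact: psd_one_minus.
have := psd_sqrt_iter n.
have : x * sqrt_iter (1 - x * x) n = sqrt_iter (1 - x * x) n * x.
  by apply: sqrt_iter_comm; ncring.
rewrite /=; move: (sqrt_iter _ n) IH => z IH xz z0.
have -> : 1 - 2^-1 *: (1 - x * x + z * z) - x =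
    2^-1 *: ((1 - z - x) * (z + (1 - x))).
  have -> : (1 - z - x) * (z + (1 - x)) =
      2 *: (1 : M) - (1 - x * x + z * z) - 2 *: x.
    rewrite !scaler_nat !mulr2n; ncexpand; rewrite xz; zmod.
  by rewrite !scalerBr !scalerA mulVf// !scale1r.
apply: psdZ; first by rewrite invr_ge0.
apply: psdM => //; first by apply: psdD => //; exact: psd_one_minus.
ncexpand; rewrite xz; zmod.
Qed.

End Absolute.

(** [p] is the absolute value, the root of [h^2] computed after scaling [h] to norm 1. The iteration
    sees only the square, so [psd_sqrt_iter_sub] for [x] and for [-x] gives both bounds in the
    limit. *)
Lemma psd_abs h : star h = h -> exists p,
  [/\ p * p = h * h, p * h = h * p, psd (p - h), psd (p + h)
    & forall a, h = embed a -> exists b, p = embed b].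
Proof.
move=> hs; have [h0|hn] := eqVneq h 0.
  exists 0; rewrite h0 mulr0 subr0 addr0; split=> //; try exact: psd0.
  by exists 0; rewrite embed0.
have t0 : 0 < `|h| by rewrite normr_gt0.
set x := `|h|^-1 *: h; have xs : star x = x.
  by rewrite star_scaler ?invr_ge0 ?normr_ge0// hs.
have x1 : `|x| <= 1.
  by rewrite normrZ ger0_norm ?invr_ge0// mulVf// gt_eqF.
have hx : h = `|h| *: x by rewrite scalerA divff ?gt_eqF// scale1r.
have y1 : `|1 - x * x| <= 1 by exact: norm_one_minus_sqr.
set q := sqrt_one_minus (1 - x * x).
have qK : q * q = x * x by rewrite sqrt_one_minusK//; zmod.
have qe a : x * x = embed a -> exists b, q = embed b.
  by move=> xa; apply: (@sqrt_one_minus_embed _ _ _ y1 a); rewrite -xa; zmod.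
have xq : q * x = x * q.
  by rewrite sqrt_one_minus_comm//; ncring.
have qx z : star z = z -> `|z| <= 1 -> z * z = x * x -> psd (q - z).
  move=> zs z1 zx; rewrite /q -zx.
  have qz : (1 - sqrt_iter (1 - z * z) n - z) @[n --> \oo] -->
      sqrt_one_minus (1 - z * z) - z.
    by apply: cvgB; [apply: cvg_sqrt_one_minus; rewrite zx|exact: cvg_cst].
  by apply: (psd_cvg qz) => n; exact: psd_sqrt_iter_sub.
have xE : x = `|h|^-1 *: h by [].
clearbody q x; move: `|h| t0 hx xE => t /ltW t0 hx xE.
exists (t *: q); split.
- by rewrite hx -!mscaleAl -!mscaleAr qK.
- by rewrite hx -!mscaleAl -!mscaleAr xq.
- by rewrite hx -scalerBr; apply: psdZ => //; exact: qx.
- rewrite hx -scalerDr; apply: psdZ => //; rewrite -[x in q + x]opprK.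
  by apply: qx; rewrite ?starN ?xs ?normrN// mulNr mulrN opprK.
- move=> a ha; have [|b ->] := qe ((t^-1 *: a) ** (t^-1 *: a)).
    by rewrite embedM !embedZ -ha -xE.
  by exists (t *: b); rewrite embedZ.
Qed.

End Positivity.

(** * Positivity of [star c * c] and of compressions *)

Section StarSquares.
Context {R : realType} {A : cstarAlgType R}.
Local Notation M := (multiplier A).
Implicit Types (h k m r c : M) (a b : A).

(** Two uses of [norm_sqr] give [|m|^4 = |m^4| = 0]. *)
Lemma selfadj_cube_eq0 m : star m = m -> m * m * m = 0 -> m = 0.
Proof.
move=> ms m3; have := norm_sqr (selfadj_sqr ms).
rewrite mulrA m3 mul0r normr0 norm_sqr// => /esym/eqP.
by rewrite !sqrf_eq0 normr_eq0 => /eqP.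
Qed.

(** [m] is the negative part [(p - h) / 2], with [p] the absolute value; [h m = - m^2] says that it
    is orthogonal to the positive part. *)
Lemma psd_negative_part h : star h = h -> exists m,
  [/\ psd m, h * m = - (m * m), m * h = - (m * m) & m = 0 -> psd h].
Proof.
move=> /psd_abs[p [pp ph p0 q0 _]]; exists (2^-1 *: (p - h)); split.
- by apply: psdZ; rewrite ?invr_ge0.
- have -> : 2^-1 *: (p - h) * (2^-1 *: (p - h)) =
      2^-1 *: (2^-1 *: (2 *: (h * h - h * p))).
    rewrite -mscaleAl -mscaleAr; congr (_ *: (_ *: _)).
    by rewrite scaler_nat mulr2n; ncexpand; rewrite pp ph; zmod.
  by rewrite -mscaleAr -scalerN scalerK// mulrBr opprB.
- have -> : 2^-1 *: (p - h) * (2^-1 *: (p - h)) =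
      2^-1 *: (2^-1 *: (2 *: (h * h - h * p))).
    rewrite -mscaleAl -mscaleAr; congr (_ *: (_ *: _)).
    by rewrite scaler_nat mulr2n; ncexpand; rewrite pp ph; zmod.
  by rewrite -mscaleAl -scalerN scalerK// mulrBl opprB ph.
- move=> /eqP; rewrite scaler_eq0 invr_eq0 pnatr_eq0/= subr_eq0 => /eqP e.
  have -> : h = 2^-1 *: (p + h).
    by rewrite e (_ : h + h = 2 *: h) ?scalerK// scaler_nat mulr2n.
  by apply: psdZ; rewrite ?invr_ge0.
Qed.

(** [c * star c + star c * c] is half the sum of the squares of the selfadjoint elements [u] and
    [v]. *)
Lemma psd_star_mul_swap c : psd (- (star c * c)) -> psd (c * star c).
Proof.
move=> c0; set u := c + star c; set v := 'i *: (c - star c).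
have us : star u = u by rewrite starD starK addrC.
have vs : star v = v.
  by rewrite starZ conjCi starB starK scaleNr -scalerN opprB.
have ii : 'i * 'i = -1 :> R[i] by rewrite -expr2 sqrCi.
have -> : c * star c = 2^-1 *: (u * u + v * v) + - (star c * c).
  have -> : u * u + v * v = 2 *: (c * star c + star c * c).
    rewrite scaler_nat mulr2n /u /v -mscaleAl -mscaleAr scalerA ii scaleN1r.
    by ncring.
  by rewrite scalerK//; zmod.
apply: psdD => //; apply: psdZ; first by rewrite invr_ge0.
by apply: psdD; exact: psd_sqr.
Qed.

(* With [T = c c^*] and [mu = |S| = |T|], compressing [(mu - T)^2] by [c] gives
   [- S (mu + S)^2], of norm at most [mu^3] because [|mu - T| <= mu], and at
   least [2 mu^3] because the terms of its expansion are positive. *)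
Lemma psd_opp_star_mul_eq0 c : psd (- (star c * c)) -> c = 0.
Proof.
set S := - (star c * c) => S0; have T0 := psd_star_mul_swap S0.
set T := c * star c in T0; set mu := `|S|.
have mu0 : 0 <= mu by exact: normr_ge0.
have cmu : `|c| ^+ 2 = mu by rewrite /mu /S normrN -mmulE cstar_identity.
have Tmu : `|T| <= mu.
  by rewrite -cmu (le_trans (ler_mnormM _ _))// cnorm_star expr2.
set D := mu *: (1 : M) - T; have Dmu : `|D| <= mu by exact: psd_bound.
have DE : - (star c * (D * D) * c) =
    (mu * mu) *: S + mu *: (S * S) + S * S * S + mu *: (S * S).
  rewrite /D /S /T !(mulrDl, mulrDr, mulrN, mulNr) -!mscaleAl -!mscaleAr.
  rewrite -!mscaleAl !scalerA !mul1r !mulr1 !scalerN !mulrA; zmod.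
have X3 : `|star c * (D * D) * c| <= mu * mu * mu.
  rewrite (le_trans (ler_mnormM _ _))// (@le_trans _ _ (`|c| * (mu * mu) * `|c|))//.
    rewrite ler_wpM2r// (le_trans (ler_mnormM _ _))// cnorm_star ler_wpM2l//.
    by rewrite (le_trans (ler_mnormM _ _))// ler_pM.
  by rewrite mulrAC -expr2 cmu mulrA.
have SS0 : psd (S * S) by apply: psdM.
have SSS0 : psd (S * S * S) by apply: psdM; rewrite ?mulrA.
have h3 : 2 * (mu * mu * mu) <= mu * mu * mu.
  rewrite (le_trans _ X3)// -normrN DE.
  have -> : 2 * (mu * mu * mu) = `|(2 * mu) *: (S * S)|.
    rewrite normrZ norm_sqr; last by case: S0.
    by rewrite ger0_norm ?mulr_ge0// -/mu expr2 !mulrA.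
  have -> : (mu * mu) *: S + mu *: (S * S) + S * S * S + mu *: (S * S) =
      (2 * mu) *: (S * S) + ((mu * mu) *: S + S * S * S).
    by rewrite -(scalerA 2 mu) scaler_nat mulr2n; zmod.
  apply: psd_ler_normD; first by apply: psdZ; rewrite ?mulr_ge0.
  by apply: psdD => //; apply: psdZ; rewrite ?mulr_ge0.
have : mu * mu * mu <= 0.
  by rewrite -(lerD2r (mu * mu * mu)) add0r -mulr2n -mulr_natl.
rewrite -expr2 -exprSr => h4; apply/eqP; rewrite -normr_eq0 -sqrf_eq0 cmu.
have : mu ^+ 3 == 0 by rewrite eq_le h4 exprn_ge0.
by rewrite expf_eq0.
Qed.

(** If [m] is the negative part of [star c * c], then [star (c m) (c m) = - m^3], so [c m = 0] by
    [psd_opp_star_mul_eq0]. Hence [m^3 = 0] and [m = 0]. *)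
Lemma psd_star_mul c : psd (star c * c).
Proof.
have hs : star (star c * c) = star c * c by rewrite mstar_mul starK.
have [m [m0 hm mh]] := psd_negative_part hs; apply.
have ms : star m = m by case: m0.
have cm : c * m = 0.
  apply: psd_opp_star_mul_eq0; rewrite mstar_mul ms.
  have -> : - (m * star c * (c * m)) = m * m * m.
    by rewrite -mulrA [star c * _]mulrA hm mulrN opprK mulrA.
  by apply: psdM; rewrite ?mulrA//; exact: psdM.
apply: selfadj_cube_eq0 => //.
by rewrite -[m * m]opprK -hm -[star c * c * m]mulrA cm mulr0 oppr0 mul0r.
Qed.

Lemma psd_conj c h : psd h -> psd (star c * h * c).
Proof.
move=> /psd_sqrt[r [rs <- _ _]].
have -> : star c * (r * r) * c = star (r * c) * (r * c).
  by rewrite mstar_mul rs !mulrA.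
exact: psd_star_mul.
Qed.

Lemma is_positive_psd h : is_positive h <-> psd h.
Proof.
split=> [[b ->]|/psd_sqrt[r [rs rh _ _]]]; first exact: psd_star_mul.
by exists r; rewrite rs mmulE rh.
Qed.

Lemma embed_inj : injective (embed : A -> M).
Proof.
move=> a b ab; apply/eqP; rewrite -subr_eq0 -normr_eq0 -norm_embed embedB ab.
by rewrite subrr normr0.
Qed.

(** From right to left the witness must lie in A: it is the root of [embed a], which [psd_sqrt]
    keeps there. *)
Lemma is_positive_embed a : is_positive a <-> psd (embed a).
Proof.
split=> [[b ->]|/psd_sqrt[r [rs ra _ /(_ a erefl)[b rb]]]].
  by rewrite embedM embed_star; exact: psd_star_mul.
exists b; apply: embed_inj.
by rewrite embedM embed_star -rb rs mmulE ra.
Qed.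

Lemma mul_embed_eq0 m : (forall a, m * embed a = 0) -> m = 0.
Proof.
move=> h; apply: multiplierP => a; apply: embed_inj.
by rewrite embed_lact mmulE h embed0.
Qed.

Lemma embed_mul_eq0 m : (forall a, embed a * m = 0) -> m = 0.
Proof.
move=> h; rewrite -[m]starK (_ : star m = 0) ?star0//; apply: mul_embed_eq0 => a.
by rewrite -[embed a]starK -embed_star -mstar_mul h star0.
Qed.

(** Polarization: [d = star m - m] vanishes on the diagonal, and the expansions at [a' + b] and
    [a' + i b] leave the sum and the difference of the two cross terms. *)
Lemma compress_selfadj m :
  (forall a, star (star (embed a) * m * embed a) = star (embed a) * m * embed a)
  -> star m = m.
Proof.
move=> h; set d := star m - m.
have d0 a : star (embed a) * d * embed a = 0.
  by rewrite /d mulrBr mulrBl -[X in _ - X]h !mstar_mul starK !mulrA subrr.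
suff : d = 0 by move/eqP; rewrite subr_eq0 => /eqP.
clearbody d; apply: mul_embed_eq0 => b; apply: embed_mul_eq0 => a.
have key a' : star (embed a') * d * embed b = 0.
  have h1 := d0 (a' + b); have h2 := d0 (a' + 'i *: b).
  move: h1 h2; rewrite !embedD !starD embedZ starZ conjCi scaleNr.
  set x := star (embed a'); set y := star (embed b).
  set z := embed a'; set w := embed b.
  have e1 : (x + y) * d * (z + w) =
    x * d * z + y * d * w + (x * d * w + y * d * z) by ncring.
  have e2 : (x - 'i *: y) * d * (z + 'i *: w) =
      x * d * z + y * d * w + 'i *: (x * d * w - y * d * z).
    have ii : 'i * 'i = -1 :> R[i] by rewrite -expr2 sqrCi.
    rewrite !mulrDr !mulrBl -!mscaleAl -!mscaleAr.
    rewrite scalerA ii scaleN1r.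
    by rewrite scalerBr; zmod.
  rewrite e1 e2 /x /y /z /w !d0 !add0r => h1 /eqP.
  rewrite scaler_eq0 (negPf (neq0Ci _))/= => /eqP h2.
  have : 2 *: (star (embed a') * d * embed b) = 0.
    by rewrite scaler_nat mulr2n -[RHS]addr0 -{1}h1 -h2; zmod.
  by move=> /eqP; rewrite scaler_eq0 pnatr_eq0/= => /eqP.
have := key (star a); rewrite -embed_star starK -mulrA; exact.
Qed.

(** Compressing by [n a], with [n] the negative part, gives [- star a n^3 a]. With [r] the root of
    [n^3] this is [- star (r a) (r a)], so its positivity forces [r a = 0] for all [a]. *)
Lemma psd_compress m : (forall a, psd (star (embed a) * m * embed a)) -> psd m.
Proof.
move=> h; have ms : star m = m by apply: compress_selfadj => a; case: (h a).
have [n [n0 mn nm]] := psd_negative_part ms; apply.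
have ns : star n = n by case: n0.
have n3 : psd (n * n * n) by apply: psdM; rewrite ?mulrA//; exact: psdM.
apply: selfadj_cube_eq0 => //.
have [r [rs rn _ _]] := psd_sqrt n3.
suff : r = 0 by rewrite -rn => ->; rewrite mul0r.
apply: mul_embed_eq0 => a; apply: psd_opp_star_mul_eq0.
have := h (lact n a); rewrite embed_lact mmulE !mstar_mul ns rs.
have -> : star (embed a) * n * m * (n * embed a) =
    - (star (embed a) * r * (r * embed a)) => //.
by rewrite -mulrA [m * _]mulrA mn -!mulrA [r * (r * _)]mulrA rn; ncring.
Qed.

End StarSquares.
(** * Positive maps *)

(** Carries the linearity proof as an argument, so that a bare function can receive a canonical
    linear structure. *)
Definition linear_fun (R : realType) (A : cstarAlgType R) (f : A -> A)
  of linear f := f.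

HB.instance Definition _ (R : realType) (A : cstarAlgType R) (f : A -> A)
  (fl : linear f) := GRing.isLinear.Build R[i] A A *:%R (linear_fun fl) fl.

Section PositiveMaps.
Context {R : realType} {A : cstarAlgType R}.
Local Notation M := (multiplier A).
Implicit Types (a b p q : A) (f : A -> A).

Lemma linear_bundle f : linear f -> exists g : {linear A -> A}, f = g.
Proof.
by move=> fl; exists (linear_fun fl : {linear A -> A}).
Qed.

Lemma is_positive_selfadj a : is_positive a -> star a = a.
Proof. by move=> [b ->]; rewrite starM starK. Qed.

Lemma is_positive0 : is_positive (0 : A).
Proof. by exists 0; rewrite cmul0r. Qed.

Lemma is_positiveD a b : is_positive a -> is_positive b -> is_positive (a + b).
Proof.
by rewrite !is_positive_embed embedD => a0 b0; exact: psdD.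
Qed.

Lemma is_positiveZ (l : R[i]) a : 0 <= l -> is_positive a ->
  is_positive (l *: a).
Proof. by rewrite !is_positive_embed embedZ => l0 a0; exact: psdZ. Qed.

Lemma is_positive_ler_normD a b : is_positive a -> is_positive b ->
  `|a| <= `|a + b|.
Proof.
rewrite !is_positive_embed -(norm_embed a) -(norm_embed (a + b)) embedD.
exact: psd_ler_normD.
Qed.

Lemma cvg_embed_lim (u : nat -> A) a : u @ \oo --> a ->
  embed (u n) @[n --> \oo] --> (embed a : M).
Proof.
move=> /cvgrPdist_lt ua; apply/cvgrPdist_lt => e /ua; apply: filterS => n.
by rewrite -embedB norm_embed.
Qed.

Lemma is_positive_cvg (u : nat -> A) a : u @ \oo --> a ->
  (forall n, is_positive (u n)) -> is_positive a.
Proof.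
move=> ua u0; apply/is_positive_embed; apply: psd_cvg (cvg_embed_lim ua) _ => n.
exact/is_positive_embed.
Qed.

(** The parts are [(b + a) / 2] and [(b - a) / 2], with [b] the absolute value; [b] and [a] have the
    same norm because their squares agree. *)
Lemma selfadj_decomposition a : star a = a -> exists p q,
  [/\ is_positive p, is_positive q, `|p| <= `|a|, `|q| <= `|a| & a = p - q].
Proof.
move=> sa; have ea : star (embed a) = embed a :> M by rewrite -embed_star sa.
have [m [mm _ m1 m2 /(_ a erefl)[b mb]]] := psd_abs ea.
(* [m] is the mean of the two positive elements given by [psd_abs]. *)
have ms : star m = m.
  have e : m = 2^-1 *: ((m - embed a) + (m + embed a)).
    by rewrite (_ : _ + _ = 2 *: m) ?scalerK// scaler_nat mulr2n; zmod.
  by rewrite {1}e star_scaler ?invr_ge0// starD (proj1 m1) (proj1 m2) -e.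
have ba : `|b| = `|a|.
  rewrite -(norm_embed b) -(norm_embed a) -mb.
  by apply/eqP; rewrite -(@eqrXn2 _ 2)// -!norm_sqr// mm.
have nh c : `|c| <= `|b| + `|a| -> `|2^-1 *: c| <= `|a|.
  move=> h; rewrite normrZ ger0_norm ?invr_ge0// ler_pdivrMl//.
  by rewrite (le_trans h)// ba mulr_natl mulr2n.
exists (2^-1 *: (b + a)), (2^-1 *: (b - a)); split.
- apply: is_positiveZ; rewrite ?invr_ge0//; apply/is_positive_embed.
  by rewrite embedD -mb.
- apply: is_positiveZ; rewrite ?invr_ge0//; apply/is_positive_embed.
  by rewrite embedB -mb.
- by apply: nh; exact: ler_normD.
- by apply: nh; exact: ler_normB.
- rewrite -scalerBr (_ : b + a - (b - a) = 2 *: a) ?scalerK//.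
  by rewrite scaler_nat mulr2n; zmod.
Qed.

Lemma positive_decomposition a : exists p q r s,
  [/\ is_positive p /\ is_positive q, is_positive r /\ is_positive s,
      `|p| <= `|a| /\ `|q| <= `|a|, `|r| <= `|a| /\ `|s| <= `|a|
    & a = (p - q) + 'i *: (r - s)].
Proof.
have ii : 'i * 'i = -1 :> R[i] by rewrite -expr2 sqrCi.
have nh c : `|c| <= `|a| + `|a| -> `|2^-1 *: c| <= `|a|.
  move=> h; rewrite normrZ ger0_norm ?invr_ge0// ler_pdivrMl//.
  by rewrite (le_trans h)// mulr_natl mulr2n.
have [|p [q [p0 q0 pa qa e1]]] := @selfadj_decomposition (2^-1 *: (a + star a)).
  by rewrite star_scaler ?invr_ge0// starD starK addrC.
(* The imaginary part of [a], since [i (star a - a) / 2 = (a - star a) / (2 i)]. *)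
have [|r [s [r0 s0 ra sa e2]]] :=
    @selfadj_decomposition (2^-1 *: ('i *: (star a - a))).
  rewrite star_scaler ?invr_ge0// starZ conjCi starB starK.
  by rewrite scaleNr -scalerN opprB.
have n1 : `|2^-1 *: (a + star a)| <= `|a|.
  by apply: nh; rewrite (le_trans (ler_normD _ _))// cnorm_star.
have n2 : `|2^-1 *: ('i *: (star a - a))| <= `|a|.
  apply: nh; rewrite normrZ normCi mul1r (le_trans (ler_normB _ _))//.
  by rewrite cnorm_star.
exists p, q, r, s; split=> //.
- by split; [apply: le_trans pa _|apply: le_trans qa _].
- by split; [apply: le_trans ra _|apply: le_trans sa _].
- rewrite -e1 -e2 !scalerA mulrAC ii mulN1r scaleNr -scalerN -scalerDr.
  by rewrite (_ : _ + _ = 2 *: a) ?scalerK// scaler_nat mulr2n; zmod.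
Qed.

(** Positive elements span A, and they and their images are selfadjoint. *)
Lemma positive_map_star f : positive_map f -> {morph f : a / star a}.
Proof.
move=> [/linear_bundle[g ->] g0] a.
have [p [q [r [s [[p0 q0] [r0 s0] _ _ ->]]]]] := positive_decomposition a.
have gs b : is_positive b -> star (g b) = g b.
  by move=> /g0; exact: is_positive_selfadj.
have bs := is_positive_selfadj.
have gD x y : g (x + y) = g x + g y by exact: linearD.
have gZ l x : g (l *: x) = l *: g x by exact: linearZ.
have gN x : g (- x) = - g x by exact: linearN.
rewrite !starD starZ conjCi !starD !starN (bs _ p0) (bs _ q0) (bs _ r0).
rewrite (bs _ s0) !(gD, gZ, gN) !starD starZ conjCi !starD !starN.
by rewrite (gs _ p0) (gs _ q0) (gs _ r0) (gs _ s0).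
Qed.

(** Otherwise there are positive [u n] in the unit ball with [|g (u n)| > n 2^(n+1)]. The sum [a] of
    the [b n = 2^-(n+1) u n] dominates each term, so [|g a| >= |g (b n)| >= n] for all [n]. *)
Lemma positive_map_bounded_on_positive f : positive_map f ->
  exists K : nat, forall a, is_positive a -> `|a| <= 1 -> `|f a| <= K%:R.
Proof.
move=> [/linear_bundle[g ->] g0]; apply: contrapT => /forallNP h.
have {}h n : exists a, [/\ is_positive a, `|a| <= 1
    & (n * 2 ^ n.+1)%:R < `|g a|].
  have /existsNP[a /not_implyP[a0 /not_implyP[a1 an]]] := h (n * 2 ^ n.+1)%N.
  by exists a; split=> //; rewrite real_ltNge ?realn ?normr_real//; apply/negP.
have {h}[u hu] := choice h.
pose b n := (2 ^+ n.+1)^-1 *: u n.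
have b0 n : is_positive (b n).
  by apply: is_positiveZ; [rewrite invr_ge0 exprn_ge0|case: (hu n)].
pose s n := \sum_(k < n) b k.
have /cvg_ex[a sa] : cvg (s @ \oo).
  (* The sequence [- 2^-n] has increments [2^-(n+1)], which bound the norms of the [b n]. *)
  apply: (@cvg_dominated_increments _ _ _ (fun n => - (2^-1) ^+ n)).
    move=> n; have -> : s n.+1 - s n = b n.
      by rewrite /s big_ord_recr/= addrAC subrr add0r.
    rewrite normrZ ger0_norm ?invr_ge0 ?exprn_ge0//.
    have -> : - 2^-1 ^+ n.+1 - - 2^-1 ^+ n = (2 ^+ n.+1)^-1 :> R.
      by rewrite -exprVn exprS; field.
    rewrite fmorphV rmorphXn rmorph_nat ler_piMr ?invr_ge0 ?exprn_ge0//.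
    by case: (hu n).
  apply: is_cvgN; apply: cvgP; apply: cvg_expr.
  by rewrite ger0_norm ?invr_ge0// invf_lt1// ltr1n.
(* The shift by [n.+1] makes every partial sum contain [b n]; removing it leaves a sum of positive
   elements. *)
have rest n : is_positive (a - b n).
  have h : s (k + n.+1)%N - b n @[k --> \oo] --> a - b n.
    apply: cvgB; last exact: cvg_cst.
    by rewrite (cvg_shiftn n.+1 s).
  apply: (is_positive_cvg h); elim=> [|k IH].
    rewrite add0n /s big_ord_recr/= addrK; elim/big_ind : _ => //.
      exact: is_positive0.
    by move=> *; exact: is_positiveD.
  by rewrite addSn /s big_ord_recr/= addrAC; exact: is_positiveD.
have bd n : n%:R <= `|g a|.
  have -> : a = b n + (a - b n) by zmod.
  have gr := is_positive_ler_normD (g0 _ (b0 n)) (g0 _ (rest n)).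
  rewrite linearD (le_trans _ gr)//.
  rewrite /b linearZ normrZ ger0_norm ?invr_ge0 ?exprn_ge0//.
  rewrite ler_pdivlMl ?exprn_gt0// mulrC -natrX -natrM ltW//.
  by case: (hu n).
have er : `|g a| = (complex.Re `|g a|)%:C by rewrite RRe_real// normr_real.
have := bd (Num.bound (complex.Re `|g a|)).
rewrite er -(rmorph_nat (real_complex R)) lecR leNgt => /negP; apply.
by rewrite (le_lt_trans _ (archi_boundP _))// -ler0c -er.
Qed.

(** The factor 4 counts the elements in [positive_decomposition], each of norm at most [|a|]. *)
Lemma positive_map_bounded f : positive_map f ->
  exists2 K : R[i], 0 <= K & forall a, `|f a| <= K * `|a|.
Proof.
move=> fp; have [K hK] := positive_map_bounded_on_positive fp.
have [/linear_bundle[g fg] _] := fp; rewrite {}fg in fp hK *.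
have {}hK a b : is_positive b -> `|b| <= `|a| -> `|g b| <= K%:R * `|a|.
  have [->|a0] := eqVneq a 0.
    by rewrite !normr0 normr_le0 => _ /eqP ->; rewrite linear0 normr0 mulr0.
  have a0' : 0 < `|a| by rewrite normr_gt0.
  move=> b0 ba; have := hK (`|a|^-1 *: b).
  rewrite linearZ !normrZ ger0_norm ?invr_ge0// !ler_pdivrMl// mulr1 mulrC.
  by apply => //; apply: is_positiveZ; rewrite ?invr_ge0.
exists (4 * K%:R); first by rewrite mulr_ge0.
move=> a; have [p [q [r [s [[p0 q0] [r0 s0] [pa qa] [ra sa] e]]]]] :=
  positive_decomposition a.
rewrite {1}e linearD linearZ !linearB/=.
have -> : 4 * K%:R * `|a| =
    (K%:R * `|a| + K%:R * `|a|) + (K%:R * `|a| + K%:R * `|a|) by ring.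
rewrite (le_trans (ler_normD _ _))// lerD//.
  by rewrite (le_trans (ler_normB _ _))// lerD// hK.
rewrite normrZ normCi mul1r.
by rewrite (le_trans (ler_normB _ _))// lerD// hK.
Qed.

Lemma endomorphism_positive f : endomorphism f -> positive_map f.
Proof.
by move=> [fl fM fs]; split=> // _ [b ->]; exists (f b); rewrite fM fs.
Qed.

End PositiveMaps.
(** * Approximate units *)

Section ApproximateUnit.
Context {R : realType} {A : cstarAlgType R}.
Local Notation M := (multiplier A).
Implicit Types (a b e : A).

Lemma psdX (h : M) n : psd h -> psd (h ^+ n).
Proof.
move=> h0; elim: n => [|n IH]; last first.
  by rewrite exprS; apply: psdM => //; rewrite -exprS -exprSr.
by rewrite expr0 -[1]subr0; apply: psd_one_minus; rewrite ?star0 ?normr0.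
Qed.

(* The induction is on [D n = 1 - B^n - n (1 - B) B^n], for which
   [D (n+1) - D n = (n+1) (1 - B)^2 B^n]. *)
Lemma psd_decay (B : M) n : psd B -> psd (1 - B) ->
  psd (1 - (1 - B) * B ^+ n *+ n).
Proof.
move=> B0 B1; set H := 1 - B.
have BH k : B ^+ k * H = H * B ^+ k.
  by rewrite /H mulrBr mulrBl mulr1 mul1r -exprS -exprSr.
have Bn k : psd (B ^+ k) by exact: psdX.
suff h : psd (1 - B ^+ n - H * B ^+ n *+ n).
  have -> : 1 - H * B ^+ n *+ n = (1 - B ^+ n - H * B ^+ n *+ n) + B ^+ n.
    by zmod.
  exact: psdD.
elim: n => [|n IH]; first by rewrite expr0 mulr0n subrr subr0; exact: psd0.
have -> : 1 - B ^+ n.+1 - H * B ^+ n.+1 *+ n.+1 =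
    (1 - B ^+ n - H * B ^+ n *+ n) + H * (H * B ^+ n) *+ n.+1.
  have -> : B ^+ n.+1 = B ^+ n - H * B ^+ n.
    by rewrite -BH /H mulrBr mulr1 -exprSr opprB addrCA subrr addr0.
  by rewrite mulrBr mulrnBl [H * B ^+ n *+ n.+1]mulrSr; zmod.
apply: psdD => //; apply: psdMn.
apply: psdM => //; first by apply: psdM => //; rewrite BH.
by rewrite -mulrA BH.
Qed.

Lemma natr_bound (x : R[i]) : 0 <= x -> exists n, x < n%:R.
Proof.
move=> x0; have er : x = (complex.Re x)%:C by rewrite RRe_real// ger0_real.
exists (Num.bound (complex.Re x)).
by rewrite er -(rmorph_nat (real_complex R)) ltcR archi_boundP// -ler0c -er.
Qed.

(** This keeps [1 - (1 - h)^n] in A although the unit is only available in M(A). *)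
Lemma exp_one_minus_embed h n :
  exists e, 1 - embed e = (1 - embed h) ^+ n :> M.
Proof.
elim: n => [|n [e he]]; first by exists 0; rewrite embed0 subr0.
exists (e + h - e ** h); rewrite exprSr -he embedB embedD embedM mmulE.
by ncring.
Qed.

(** Put [B = 1 - H0 / T] and [e = 1 - B^n]. The square of [|e a - a|] is the norm of
    [B^n a star a B^n], at most that of [B^n H0 B^n = T (1 - B) B^(2n)], which [psd_decay] bounds by
    [T / (2n)]. The other side is symmetric. *)
Lemma approximate_unit (s : seq A) (eps : R[i]) : 0 < eps ->
  exists e, forall a, a \in s -> `|e ** a - a| <= eps /\ `|a ** e - a| <= eps.
Proof.
move=> eps0; pose F a := a ** star a + star a ** a.
have F0 a : is_positive (F a).
  by apply: is_positiveD; [exists (star a); rewrite starK|exists a].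
pose H0 := \sum_(a <- s) F a.
have S0 (r : seq A) : is_positive (\sum_(a <- r) F a).
  by elim/big_ind : _ => //; [exact: is_positive0|exact: is_positiveD].
(* Adding 1 makes [T] invertible even if [H0 = 0], and [h] still has norm at most 1. *)
set T := `|H0| + 1; have T0 : 0 < T by rewrite ltr_wpDl.
pose h := T^-1 *: H0.
have h0 : psd (embed h : M).
  by apply/is_positive_embed; apply: is_positiveZ (S0 s);
    rewrite invr_ge0 ltW.
have h1 : psd (1 - embed h : M).
  apply: psd_one_minus; first by case: h0.
  rewrite norm_embed normrZ ger0_norm ?invr_ge0 ?(ltW T0)//.
  by rewrite ler_pdivrMl// mulr1 lerDl.
have [n hn] : exists n, T / eps ^+ 2 < n%:R.
  by apply: natr_bound; rewrite divr_ge0 ?exprn_ge0 ?ltW.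
have [e he] := exp_one_minus_embed h n; exists e => a sa.
set B := 1 - embed h in h1 he.
have Bs : star (B ^+ n) = B ^+ n by rewrite starX; case: h1 => ->.
have HB : 1 - B = embed h by rewrite /B; zmod.
have BHB : `|B ^+ n * embed H0 * B ^+ n| <= eps ^+ 2.
  have -> : embed H0 = T *: (1 - B).
    by rewrite HB /h embedZ scalerA divff ?gt_eqF// scale1r.
  have -> : B ^+ n * (T *: (1 - B)) * B ^+ n = T *: ((1 - B) * B ^+ (n + n)).
    rewrite -mscaleAr -mscaleAl exprD; congr (_ *: _).
    by rewrite [in RHS]mulrA; congr (_ * _); rewrite mulrBr mulrBl mulr1 mul1r
      -exprS -exprSr.
  have d : psd (1 - (1 - B) * B ^+ (n + n) *+ (n + n)).
    by apply: psd_decay => //; rewrite HB.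
  move: d; set X := (1 - B) * _; set N := (n + n)%N => d.
  have X0 : psd X.
    apply: psdM; rewrite ?HB//; first exact: psdX.
    by rewrite -HB mulrBr mulrBl mulr1 mul1r -exprS -exprSr.
  have XN : `|X| * N%:R <= 1.
    rewrite mulr_natr -normrMn; apply: psd_norm_le => //; first exact: psdMn.
    by rewrite scale1r.
  rewrite normrZ (gtr0_norm T0).
  rewrite (@le_trans _ _ (eps ^+ 2 * (`|X| * N%:R)))//; last first.
    by rewrite ler_piMr// exprn_ge0// ltW.
  rewrite mulrCA [leLHS]mulrC ler_wpM2l// -ler_pdivrMl ?exprn_gt0//.
  by rewrite mulrC (le_trans (ltW hn))// ler_nat leq_addr.
(* One occurrence of [a] is split off; the remaining sum is positive, so dropping it does not
   increase norms. *)
have [r rE] : exists r, H0 = F a + \sum_(b <- r) F b.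
  by exists (rem a s); rewrite /H0 (big_rem a sa).
have sq (x y z : M) : psd x -> psd y -> embed H0 = x + y + z -> psd z ->
    `|B ^+ n * x * B ^+ n| <= eps ^+ 2.
  move=> x0 y0 E z0; rewrite (le_trans _ BHB)// E -addrA mulrDr mulrDl.
  have c w : psd w -> psd (B ^+ n * w * B ^+ n).
    by move=> w0; rewrite -{1}Bs; exact: psd_conj.
  by apply: psd_ler_normD; apply: c => //; exact: psdD.
have z0 : psd (embed (\sum_(b <- r) F b) : M) by apply/is_positive_embed.
have aE : embed H0 = embed a * star (embed a) + star (embed a) * embed a
    + embed (\sum_(b <- r) F b) :> M.
  by rewrite rE !embedD !embedM !embed_star.
have a1 : psd (embed a * star (embed a)).
  by rewrite -{1}[embed a]starK; exact: psd_star_mul.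
have a2 := psd_star_mul (embed a).
have eE : embed e = 1 - B ^+ n by rewrite -he; zmod.
split; rewrite -(@ler_pXn2r _ 2)// ?nnegrE ?(ltW eps0)// -norm_embed;
  rewrite embedB embedM eE mmulE.
  rewrite (_ : _ - _ = - (B ^+ n * embed a)); last by ncring.
  rewrite normrN -cnorm_star -cstar_identity starK mmulE mstar_mul Bs.
  by rewrite !mulrA -[B ^+ n * _ * _]mulrA; exact: sq a1 a2 aE z0.
rewrite (_ : _ - _ = - (embed a * B ^+ n)); last by ncring.
rewrite normrN -cstar_identity mmulE mstar_mul Bs.
rewrite mulrA -[B ^+ n * _ * embed a]mulrA.
by apply: (sq _ _ _ a2 a1 _ z0); rewrite aE; zmod.
Qed.

(** A filter takes the place of a net. The tolerance is real rather than in [R[i]], so that two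
    tolerances have a minimum. *)
Definition approximate_unit_filter : set_system A :=
  [set P | exists (s : seq A) (eps : R), 0 < eps /\
    forall e, (forall a, a \in s ->
      `|e ** a - a| <= eps%:C /\ `|a ** e - a| <= eps%:C) -> P e].

Global Instance approximate_unit_filter_proper :
  ProperFilter approximate_unit_filter.
Proof.
split.
  move=> [s [eps [eps0 h]]].
  have [|e he] := @approximate_unit s eps%:C; first by rewrite ltcR.
  exact: h he.
split.
- by exists [::], 1.
- move=> P Q [s [d [d0 hP]]] [r [d' [d'0 hQ]]].
  exists (s ++ r), (Num.min d d'); split; first by rewrite lt_min d0.
  move=> e he; split; [apply: hP|apply: hQ] => a ha.
    have [|h1 h2] := he a; first by rewrite mem_cat ha.
    by split; [apply: le_trans h1 _|apply: le_trans h2 _];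
      rewrite lecR ge_min lexx.
  have [|h1 h2] := he a; first by rewrite mem_cat ha orbT.
  by split; [apply: le_trans h1 _|apply: le_trans h2 _];
    rewrite lecR ge_min lexx orbT.
- move=> P Q PQ [s [d [d0 hP]]]; exists s, d; split => // e he.
  by apply: PQ; exact: hP.
Qed.

Lemma approximate_unit_cvg a :
  e ** a @[e --> approximate_unit_filter] --> a /\
  a ** e @[e --> approximate_unit_filter] --> a.
Proof.
have h (d : R[i]) : 0 < d -> exists eps : R, 0 < eps /\ eps%:C < d.
  move=> d0; exists (complex.Re d / 2).
  have er : d = (complex.Re d)%:C by rewrite RRe_real// ger0_real// ltW.
  have d0' : 0 < complex.Re d by rewrite -ltcR -er.
  by rewrite divr_gt0//; split => //; rewrite [ltRHS]er ltcR; lra.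
split; apply/cvgrPdistC_lt => d /h[eps [eps0 epsd]];
  exists [:: a], eps; split => // e /(_ a (mem_head _ _))[h1 h2];
  exact: le_lt_trans epsd.
Qed.

End ApproximateUnit.
(** * The strict topology *)

Section StrictConvergence.
Context {R : realType} {A : cstarAlgType R}.
Local Notation M := (multiplier A).
Implicit Types (a b e : A) (m n : M).

Lemma cvg_bounded_linear (g : A -> A) (T : Type) (F : set_system T)
    {FF : Filter F} (f : T -> A) a :
  linear g -> (exists2 K : R[i], 0 <= K & forall b, `|g b| <= K * `|b|) ->
  f @ F --> a -> g (f t) @[t --> F] --> g a.
Proof.
move=> /linear_bundle[h ->] [K K0 hK] /cvgrPdist_lt fa.
apply/cvgrPdist_lt => d d0; have K1 : 0 < K + 1 by rewrite ltr_wpDl.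
have := fa (d / (K + 1)) (divr_gt0 d0 K1); apply: filterS => t.
rewrite ltr_pdivlMr// => ht; rewrite -linearB (le_lt_trans (hK _))//.
by rewrite (le_lt_trans _ ht)// mulrC ler_wpM2l// lerDl.
Qed.

(** Written with norm limits in A, which avoids the type alias; [strict_cvgE] relates it to the
    strict topology. *)
Definition strict_cvg (T : Type) (F : set_system T) (f : T -> M) m :=
  forall a, lact (f t) a @[t --> F] --> lact m a /\
            ract (f t) a @[t --> F] --> ract m a.

Lemma strict_cvgE (T : Type) (F : set_system T) {FF : Filter F}
    (f : T -> M) m :
  strict_cvg F f m <->
  (f : T -> strict_multiplier A) @ F --> (m : strict_multiplier A).
Proof. by split=> [h|/strict_cvgP h a]; [apply/strict_cvgP|exact: h]. Qed.

Section Operations.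
Context {T : Type} {F : set_system T} {FF : ProperFilter F}.
Implicit Types f g : T -> M.

Lemma strict_cvg_unique f m n : strict_cvg F f m -> strict_cvg F f n -> m = n.
Proof.
move=> fm fn; apply: multiplierP => a.
exact: (cvg_norm_unique (fm a).1 (fn a).1).
Qed.

Lemma strict_cvgD f g m n : strict_cvg F f m -> strict_cvg F g n ->
  strict_cvg F (fun t => f t + g t) (m + n).
Proof.
by move=> fm gn a; split; apply: cvgD; [exact: (fm a).1|exact: (gn a).1
  |exact: (fm a).2|exact: (gn a).2].
Qed.

Lemma strict_cvgZ (l : R[i]) f m : strict_cvg F f m ->
  strict_cvg F (fun t => l *: f t) (l *: m).
Proof.
by move=> fm a; split; apply: cvgZr; [exact: (fm a).1|exact: (fm a).2].
Qed.

Lemma strict_cvg_star f m : strict_cvg F f m ->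
  strict_cvg F (fun t => star (f t)) (star m).
Proof.
move=> fm a; split; apply: cvg_star; [exact: (fm _).2|exact: (fm _).1].
Qed.

(** In the left action [n] only moves the point of evaluation; in the right action it is a bounded
    operator applied afterwards. *)
Lemma strict_cvgMr f m n : strict_cvg F f m ->
  strict_cvg F (fun t => f t ** n) (m ** n).
Proof.
move=> fm a; split; first exact: (fm _).1.
apply: (cvg_bounded_linear (g := ract n)); last exact: (fm a).2.
  exact: ract_linear.
by have [K [K0 _ hK]] := multiplier_ubound n; exists K.
Qed.

Lemma strict_cvgMl f m n : strict_cvg F f m ->
  strict_cvg F (fun t => n ** f t) (n ** m).
Proof.
move=> fm a; split; last exact: (fm _).2.
apply: (cvg_bounded_linear (g := lact n)); last exact: (fm a).1.
  exact: lact_linear.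
by have [K [K0 hK _]] := multiplier_ubound n; exists K.
Qed.

Lemma strictly_continuous_cvg (h : M -> M) f m : strictly_continuous h ->
  strict_cvg F f m -> strict_cvg F (fun t => h (f t)) (h m).
Proof.
move=> hc /strict_cvgE fm; apply/strict_cvgE.
exact: (cvg_comp _ _ fm (hc m)).
Qed.

End Operations.

(** Strict density of A: [(m e) a = m (e a)] and [a (m e) = (a m) e] tend to [m a] and [a m]. *)
Lemma strict_cvg_approximate_unit m :
  strict_cvg (@approximate_unit_filter R A) (fun e => embed (lact m e)) m.
Proof.
move=> a; split => /=.
  have h : lact m (e ** a) @[e --> @approximate_unit_filter R A] --> lact m a.
    apply: cvg_bounded_linear; [exact: lact_linear| |].
      by have [K [K0 hK _]] := multiplier_ubound m; exists K.
    by have [] := approximate_unit_cvg a.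
  by under eq_fun do rewrite -lactM.
under eq_fun do rewrite -ract_lact.
by have [] := approximate_unit_cvg (ract m a).
Qed.

Lemma strict_extension_unique (f : A -> A) (g h : M -> M) :
  strict_extension f g -> strict_extension f h -> g = h.
Proof.
move=> [gc gf] [hc hf]; apply/funext => m.
have cm := strict_cvg_approximate_unit m.
have PF := @approximate_unit_filter_proper R A.
have := strictly_continuous_cvg (FF := PF) hc cm.
have := strictly_continuous_cvg (FF := PF) gc cm.
have -> : (fun e => g (embed (lact m e))) = (fun e => h (embed (lact m e))).
  by apply/funext => e; rewrite gf hf.
exact: strict_cvg_unique.
Qed.

(** Limits in products are taken one factor at a time: [gMe] approximates the left factor while the
    right one lies in A, and then the right factor is approximated. *)
Lemma strict_extension_endomorphism (f : A -> A) (g : M -> M) :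
  endomorphism f -> strict_extension f g -> endomorphism g.
Proof.
move=> [fl fM fs] [gc gf].
have PF := @approximate_unit_filter_proper R A.
have unit := strict_cvg_approximate_unit.
have img m : strict_cvg (@approximate_unit_filter R A)
    (fun e => embed (f (lact m e))) (g m).
  have := strictly_continuous_cvg (FF := PF) gc (unit m).
  by under eq_fun do rewrite gf.
have gMe m b : g (m ** embed b) = g m ** embed (f b).
  have h1 := strictly_continuous_cvg (FF := PF) gc
    (strict_cvgMr (FF := PF) (embed b) (unit m)).
  have h2 := strict_cvgMr (FF := PF) (embed (f b)) (img m).
  apply: strict_cvg_unique h1 _; move: h2; congr (strict_cvg _ _ _).
  by apply/funext => e; rewrite -!embedM gf fM.
split.
- move=> l m n.
  apply: strict_cvg_unique (img _) _.
  have := strict_cvgD (FF := PF) (strict_cvgZ (FF := PF) l (img m)) (img n).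
  congr (strict_cvg _ _ _); apply/funext => e /=.
  by rewrite fl embed_linear.
- move=> m n.
  have h1 := strictly_continuous_cvg (FF := PF) gc
    (strict_cvgMl (FF := PF) m (unit n)).
  have h2 := strict_cvgMl (FF := PF) (g m) (img n).
  apply: strict_cvg_unique h1 _; move: h2; congr (strict_cvg _ _ _).
  by apply/funext => e; rewrite gMe.
- move=> m.
  have h1 := strictly_continuous_cvg (FF := PF) gc
    (strict_cvg_star (FF := PF) (unit m)).
  have h2 := strict_cvg_star (FF := PF) (img m).
  apply: strict_cvg_unique h1 _; move: h2; congr (strict_cvg _ _ _).
  by apply/funext => e; rewrite -!embed_star gf fs.
Qed.

End StrictConvergence.

(** * Transfer operators *)

Section TransferOperator.
Context {R : realType} {A : cstarAlgType R}.
Variables alpha L : A -> A.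
Hypotheses (halpha : endomorphism alpha) (hL : transfer_operator alpha L).
Local Notation M := (multiplier A).
Implicit Types (a b : A) (m : M).

(** The adjoint of the transfer identity, as [L] and [alpha] preserve the involution. *)
Lemma transfer_mull a b : L (alpha a ** b) = a ** L b.
Proof.
have [hLp hLM] := hL; have [_ _ as_] := halpha.
rewrite -[LHS]starK -(positive_map_star hLp) starM -as_ hLM starM starK.
by rewrite (positive_map_star hLp) starK.
Qed.

Lemma transfer_multiplier m : exists n : M, forall a,
  lact n a = L (lact m (alpha a)) /\ ract n a = L (ract m (alpha a)).
Proof.
have [hLp hLM] := hL; have [Ll _] := hLp; have [al aM _] := halpha.
have [K K0 hK] := positive_map_bounded hLp.
have [Q Q0 hQ] := positive_map_bounded (endomorphism_positive halpha).
have l1 : linear (fun a => L (lact m (alpha a))).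
  by move=> l a b; rewrite al linearP Ll.
have l2 : linear (fun a => L (ract m (alpha a))).
  by move=> l a b; rewrite al linearP Ll.
have b1 : exists C : R[i], forall a, `|L (lact m (alpha a))| <= C * `|a|.
  exists (K * (`|m| * Q)) => a; rewrite (le_trans (hK _))// -!mulrA ler_wpM2l//.
  by rewrite (le_trans (ler_norm_lact _ _))// ler_wpM2l.
have b2 : exists C : R[i], forall a, `|L (ract m (alpha a))| <= C * `|a|.
  exists (K * (`|m| * Q)) => a; rewrite (le_trans (hK _))// -!mulrA ler_wpM2l//.
  by rewrite (le_trans (ler_norm_ract _ _))// ler_wpM2l.
have lM a b : L (lact m (alpha (a ** b))) = L (lact m (alpha a)) ** b.
  by rewrite aM lactM hLM.
have rM a b : L (ract m (alpha (a ** b))) = a ** L (ract m (alpha b)).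
  by rewrite aM ractM transfer_mull.
(* Both sides equal [L (alpha(a) m alpha(b))]. *)
have rl a b : L (ract m (alpha a)) ** b = a ** L (lact m (alpha b)).
  by rewrite -hLM ract_lact transfer_mull.
by exists (Multiplier l1 l2 b1 b2 lM rM rl).
Qed.

Variable Lbar : M -> M.
Hypothesis LbarE : forall m a, lact (Lbar m) a = L (lact m (alpha a)) /\
  ract (Lbar m) a = L (ract m (alpha a)).

(** At each [a], the actions of [Lbar m] are the bounded map [L] applied to those of [m] at the
    fixed point [alpha a], so strict limits in [m] pass through. *)
Lemma transfer_strict_extension : strict_extension L Lbar.
Proof.
have [hLp hLM] := hL; have [Ll _] := hLp.
have Lb := positive_map_bounded hLp.
split; last by move=> a; apply: multiplierP => b; rewrite (LbarE _ _).1 /= hLM.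
move=> m.
have h : strict_cvg (nbhs (m : strict_multiplier A)) id m.
  by apply/strict_cvgE; exact: cvg_id.
suff : strict_cvg (nbhs (m : strict_multiplier A)) Lbar (Lbar m).
  by move/strict_cvgE.
move=> a; rewrite (LbarE _ _).1 (LbarE _ _).2; split.
  under eq_fun do rewrite (LbarE _ _).1.
  by apply: cvg_bounded_linear => //; exact: (h _).1.
under eq_fun do rewrite (LbarE _ _).2.
by apply: cvg_bounded_linear => //; exact: (h _).2.
Qed.

Lemma transfer_extension_positive : positive_map Lbar.
Proof.
have [[Ll Lp] hLM] := hL; have [_ aM as_] := halpha.
split=> [l m n|m].
  by apply: multiplierP => a; rewrite /= !(LbarE _ _).1 /= Ll.
move=> /is_positive_psd m0; apply/is_positive_psd/psd_compress => a.
rewrite -mulrA -mmulE -mmulE -embed_lact -embed_star -embedM (LbarE _ _).1.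
rewrite -transfer_mull as_; apply/is_positive_embed/Lp/is_positive_embed.
by rewrite embedM embed_lact embed_star !mmulE mulrA; exact: psd_conj.
Qed.

(** Multiplied by [b] on the left and applied to [a], both products become [L (alpha (b n a))]. *)
Lemma transfer_extension_central : is_central (Lbar mone).
Proof.
have [[Ll Lp] hLM] := hL; have [_ aM _] := halpha.
move=> n; apply: multiplierP => a; apply: embed_inj; apply/eqP.
rewrite -subr_eq0; apply/eqP; apply: embed_mul_eq0 => b.
rewrite mulrBr -!mmulE -!embedM /= !(LbarE _ _).1 /=.
rewrite -ract_lact -!transfer_mull -!aM ract_lact; exact: subrr.
Qed.

(** Everything reduces to [alphabar(n) alpha(a) = alpha(n a)], which holds because [alphabar] is
    multiplicative and extends [alpha]. *)
Lemma transfer_extension_transfer (alphabar : M -> M) :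
  strict_extension alpha alphabar -> transfer_operator alphabar Lbar.
Proof.
move=> ha; have [_ abM _] := strict_extension_endomorphism halpha ha.
have [_ hae] := ha; split; first exact: transfer_extension_positive.
move=> m n; apply: multiplierP => a; rewrite /= !(LbarE _ _).1 /=.
congr (L (lact m _)); apply: embed_inj.
by rewrite embed_lact -hae -abM -embed_lact hae.
Qed.

End TransferOperator.

Theorem proposition4p2 (R : realType) (A : cstarAlgType R) (alpha L : A -> A)
    (halpha : endomorphism alpha) (hL : transfer_operator alpha L) :
  extendible L /\
  forall Lbar : multiplier A -> multiplier A, strict_extension L Lbar ->
  [/\ forall m a, lact (Lbar m) a = L (lact m (alpha a)),
      forall m n, (forall a, lact n a = L (lact m (alpha a))) -> n = Lbar m,
      is_positive (Lbar mone),
      is_central (Lbar mone)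
    & forall alphabar, strict_extension alpha alphabar ->
        Exel_system alphabar Lbar].
Proof.
have [Lb LbE] := choice (transfer_multiplier halpha hL).
have hLb := transfer_strict_extension hL LbE.
(* By uniqueness an arbitrary strict extension is the one constructed. *)
split=> [|Lbar /(strict_extension_unique hLb) <-]; first by exists Lb.
have Lp := transfer_extension_positive halpha hL LbE.
split=> [m a|m n h|||alphabar ha].
- exact: (LbE m a).1.
- by apply: multiplierP => a; rewrite h (LbE m a).1.
- by apply: Lp.2; exists mone; rewrite star1 mul1m.
- exact (transfer_extension_central halpha hL LbE).
- split; first exact: strict_extension_endomorphism ha.
  exact (transfer_extension_transfer halpha hL LbE ha).
Qed.
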